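(* Let $G=\mathrm{PSL}_2(\mathbb{F}_8)$ and $H\simeq(C_2)^3$ a Sylow $2$-subgroup. There is a flabby resolution $0\to J_{G/H}\to P\to F\to0$ with $\mathrm{rank}_{\mathbb{Z}}F=73$ such that there is an isomorphism of $G$-lattices $$\mathbb{Z}[G/S_3]\oplus\mathbb{Z}[G/C_9]\oplus\mathbb{Z}[G/((C_2)^3\rtimes C_7)]^{\oplus2}\simeq\mathbb{Z}[G/S_3]\oplus\mathbb{Z}\oplus F$$ (rank $158$). In particular $F$ is stably permutation.
   Context: A $G$-lattice is a finitely generated $\mathbb{Z}[G]$-module free over $\mathbb{Z}$. A permutation $G$-lattice is one isomorphic to $\bigoplus_i\mathbb{Z}[G/H_i]$; $\mathbb{Z}$ is the trivial lattice. Stably permutation: $M\oplus P\simeq P'$ with $P,P'$ permutation. $F$ is flabby if $\widehat H^{-1}(H',F)=0$ for all subgroups $H'\le G$. A flabby resolution of $M$ is an exact sequence $0\to M\to P\to F\to0$ with $P$ permutation and $F$ flabby. The Chevalley module is $J_{G/H}=\mathrm{Hom}_{\mathbb{Z}}(I_{G/H},\mathbb{Z})$ where $I_{G/H}=\ker(\mathbb{Z}[G/H]\to\mathbb{Z})$. In $\mathrm{PSL}_2(\mathbb{F}_8)$ the subgroups isomorphic to $S_3$, $C_9$ and $(C_2)^3\rtimes C_7$ (the normalizer of a Sylow 2-subgroup) are each unique up to conjugacy. *)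

(* Defs.v *)
From HB Require Import structures.
From mathcomp Require Import all_boot all_order all_algebra all_fingroup all_solvable all_field.
Set Implicit Arguments. Unset Strict Implicit. Unset Printing Implicit Defensive.
Import GRing.Theory.

Local Open Scope ring_scope.

Section PSL.
Variable F : finFieldType.

Definition SL2_set : {set {'GL_2[F]}} := [set g | \det (GLval g) == 1].

Lemma SL2_group_set : group_set SL2_set.
Proof.
apply/group_setP; split; first by rewrite inE GL_1E det1.
by move=> x y; rewrite !inE GL_MxE det_mulmx => /eqP-> /eqP->; rewrite mulr1.
Qed.

Canonical SL2 := Group SL2_group_set.

Definition PSL2 := (SL2 / 'Z(SL2))%G.
End PSL.

(* A G-lattice of rank n is a Z-basis Z^n (column vectors) with a matrix
   representation rho : G -> GL_n(Z), g acting by v |-> rho g *m v. *)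
Section Lattices.
Variables (gT : finGroupType) (G : {group gT}).

Definition glat (n : nat) := gT -> 'M[int]_n.

Definition is_Glattice n (rho : glat n) :=
  rho 1%g = 1%:M /\ {in G &, forall g h, rho (g * h)%g = rho g *m rho h}.

Definition Ghom n m (rho : glat n) (sigma : glat m) (A : 'M[int]_(m, n)) :=
  forall g, g \in G -> A *m rho g = sigma g *m A.

Definition Giso n m (rho : glat n) (sigma : glat m) :=
  exists (A : 'M[int]_(m, n)) (B : 'M[int]_(n, m)),
    [/\ Ghom rho sigma A, B *m A = 1%:M & A *m B = 1%:M].

Definition dsum n m (rho : glat n) (sigma : glat m) : glat (n + m) :=
  fun g => block_mx (rho g) 0 0 (sigma g).

Definition triv_lat : glat 1 := fun _ => 1%:M.

Definition perm_lat (K : {group gT}) : glat #|lcosets K G| :=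
  fun g => \matrix_(i, j)
    ((lcoset (@enum_val _ (mem (lcosets K G)) j) g
        == @enum_val _ (mem (lcosets K G)) i)%:R).

Fixpoint psum_dim (s : seq {group gT}) : nat :=
  if s is K :: s' then (#|lcosets K G| + psum_dim s')%N else 0%N.

Fixpoint psum (s : seq {group gT}) : glat (psum_dim s) :=
  match s return glat (psum_dim s) with
  | [::] => fun _ => 0
  | K :: s' => dsum (perm_lat K) (psum s')
  end.

Definition is_perm n (rho : glat n) := exists s, Giso rho (psum s).

Definition stably_perm n (rho : glat n) :=
  exists s1 s2, Giso (dsum rho (psum s1)) (psum s2).

(* Tate cohomology: \hat H^{-1}(K, M) = ker(N_K) / I_K M vanishes *)
Definition tateHm1_trivial n (rho : glat n) (K : {group gT}) :=
  forall v : 'cV[int]_n, (\sum_(h in K) rho h) *m v = 0 ->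
    exists w : gT -> 'cV[int]_n, v = \sum_(h in K) (rho h - 1%:M) *m w h.

Definition flabby n (rho : glat n) :=
  forall K : {group gT}, K \subset G -> tateHm1_trivial rho K.

Definition dual_lat n (rho : glat n) : glat n := fun g => (rho g^-1%g)^T.

(* (tau, B) presents the augmentation ideal I_{G/K} = ker(Z[G/K] -> Z):
   B is an injective G-map from tau onto the kernel of augmentation *)
Definition aug_ideal (K : {group gT}) k (tau : glat k)
    (B : 'M[int]_(#|lcosets K G|, k)) :=
  [/\ is_Glattice tau, Ghom tau (perm_lat K) B,
      (forall w : 'cV[int]_k, B *m w = 0 -> w = 0) &
      (forall v : 'cV[int]_#|lcosets K G|,
          (\sum_i v i 0 = 0) <-> (exists w, v = B *m w))].

Definition short_exact k p f (i : 'M[int]_(p, k)) (pi : 'M[int]_(f, p)) :=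
  [/\ (forall w : 'cV[int]_k, i *m w = 0 -> w = 0),
      (forall u : 'cV[int]_f, exists v, pi *m v = u) &
      (forall v : 'cV[int]_p, (pi *m v = 0) <-> (exists w, v = i *m w))].

Definition flabby_resolution k p f (M : glat k) (P : glat p) (Fl : glat f)
    (i : 'M[int]_(p, k)) (pi : 'M[int]_(f, p)) :=
  [/\ [/\ is_Glattice P & is_perm P], [/\ is_Glattice Fl & flabby Fl],
      Ghom M P i, Ghom P Fl pi & short_exact i pi].

End Lattices.

Arguments aug_ideal [gT] G K [k] tau B.

(* Main.v *)
Require Import Defs.
From HB Require Import structures.
From mathcomp Require Import all_boot all_order all_algebra all_fingroup all_solvable all_field.
From mathcomp Require Import ring.
Set Implicit Arguments. Unset Strict Implicit. Unset Printing Implicit Defensive.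
Import GRing.Theory Num.Theory.

(* Dualizing, a resolution of J_{G/H} by a permutation lattice P amounts to an
   equivariant surjection Q from P onto I_{G/H}, and F is the dual of ker Q.  Here
   P = Z[G/H] + Z[G/C_7], where C_7 is a complement of H in its normalizer B; Q sends
   the base point H to H - zH, with z a generator of C_7, and sends the base point C_7
   to the difference of two C_7-orbits on G/H, so that F has rank 63 + 72 - 62 = 73.
   An explicit equivariant map b from Z[G/S_3] + Z + P to
   Z[G/S_3] + Z[G/C_9] + Z[G/B]^2 kills J_{G/H}, and is onto because the four base
   points have explicit preimages; the ranks being equal, it induces the isomorphism.
   Hence F is stably permutation, and therefore flabby.  Everything is computed in
   SL_2 over the concrete field F_2[x] / (x^3 + x + 1): the field F is isomorphic to
   it, G = SL_2(F) as its center is trivial, and the given subgroups are conjugate to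
   explicit ones, so the actions on cosets become tables of numbers. *)

Local Open Scope ring_scope.

(** * Lattices *)

Section Lattice.
Variables (gT : finGroupType) (G : {group gT}).

Lemma Giso_refl n (rho : glat gT n) : Giso G rho rho.
Proof.
by exists 1%:M, 1%:M; split=> [g _||]; rewrite ?mul1mx ?mulmx1.
Qed.

Lemma Giso_sym n m (rho : glat gT n) (sigma : glat gT m) :
  Giso G rho sigma -> Giso G sigma rho.
Proof.
case=> A [B [AG BA AB]]; exists B, A; split=> // g gG.
by rewrite -[B *m _]mulmx1 -AB !mulmxA -(mulmxA B) -AG // !mulmxA BA mul1mx.
Qed.

Lemma Giso_trans n m l (rho : glat gT n) (sigma : glat gT m) (tau : glat gT l) :
  Giso G rho sigma -> Giso G sigma tau -> Giso G rho tau.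
Proof.
case=> A [B [AG BA AB]] [A' [B' [AG' BA' AB']]].
exists (A' *m A), (B *m B'); split=> [g gG||].
- by rewrite -mulmxA AG // !mulmxA AG'.
- by rewrite mulmxA -(mulmxA B) BA' mulmx1.
- by rewrite mulmxA -(mulmxA A') AB mulmx1.
Qed.

Lemma Giso_dsum n m n' m' (rho : glat gT n) (sigma : glat gT m)
    (rho' : glat gT n') (sigma' : glat gT m') :
  Giso G rho rho' -> Giso G sigma sigma' ->
  Giso G (dsum rho sigma) (dsum rho' sigma').
Proof.
case=> A [B [AG BA AB]] [A' [B' [AG' BA' AB']]].
exists (block_mx A 0 0 A'), (block_mx B 0 0 B'); split=> [g gG||];
  rewrite /dsum !mulmx_block !mulmx0 !mul0mx ?addr0 ?add0r.
- by rewrite AG ?AG'.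
- by rewrite BA BA' -scalar_mx_block.
- by rewrite AB AB' -scalar_mx_block.
Qed.

Lemma Giso_dsumC n m (rho : glat gT n) (sigma : glat gT m) :
  Giso G (dsum rho sigma) (dsum sigma rho).
Proof.
exists (block_mx 0 1%:M 1%:M 0), (block_mx 0 1%:M 1%:M 0); split=> [g gG||];
  rewrite /dsum !mulmx_block !mulmx0 !mul0mx ?mul1mx ?mulmx1 ?addr0 ?add0r //;
  by rewrite -scalar_mx_block.
Qed.

Lemma Giso_dsumA n m l (rho : glat gT n) (sigma : glat gT m) (tau : glat gT l) :
  Giso G (dsum rho (dsum sigma tau)) (dsum (dsum rho sigma) tau).
Proof.
pose A : 'M[int]_(n + m + l, n + (m + l)) :=
  block_mx (col_mx 1%:M 0) (block_mx 0 0 1%:M 0) 0 (row_mx 0 1%:M).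
pose B : 'M[int]_(n + (m + l), n + m + l) :=
  block_mx (row_mx 1%:M 0) 0 (block_mx 0 1%:M 0 0) (col_mx 0 1%:M).
exists A, B; split=> [g gG||]; rewrite /A /B /dsum.
- rewrite !mulmx_block !mulmx0 !mul0mx !addr0 !add0r.
  rewrite ?mul_row_block ?mul_mx_row ?mul_col_mx ?mul_block_col ?mulmx_block.
  by rewrite !mul_row_col ?(mulmx0, mul0mx, mul1mx, mulmx1, addr0, add0r).
- rewrite !mulmx_block !mulmx0 !mul0mx ?addr0 ?add0r.
  rewrite mul_row_col ?mul_row_block ?mul_block_col ?mul_col_row ?mulmx_block.
  rewrite !mulmx0 !mul0mx ?mul1mx ?mulmx1 ?addr0 ?add0r.
  by rewrite row_mx0 col_mx0 ?add_block_mx ?(addr0, add0r) !scalar_mx_block.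
- rewrite !mulmx_block !mulmx0 !mul0mx ?addr0 ?add0r.
  rewrite mul_row_col ?mul_row_block ?mul_block_col ?mul_col_row ?mulmx_block.
  rewrite !mulmx0 !mul0mx ?mul1mx ?mulmx1 ?addr0 ?add0r.
  by rewrite mul_row_col mul0mx mul1mx row_mx0 col_mx0 ?add_block_mx ?(addr0, add0r) !scalar_mx_block.
Qed.

Lemma Giso_dsum0 n (rho : glat gT n) (nu : glat gT 0) : Giso G (dsum rho nu) rho.
Proof.
exists (row_mx 1%:M 0), (col_mx 1%:M 0); split=> [g gG||].
- by rewrite /dsum mul_row_block mul_mx_row !mulmx0 !mul0mx mul1mx mulmx1 !addr0.
- rewrite mul_col_row !mulmx0 mulmx1 mul0mx.
  rewrite [in RHS]scalar_mx_block; congr block_mx.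
  by rewrite [RHS]flatmx0.
- by rewrite mul_row_col mulmx0 addr0 mulmx1.
Qed.

(** The elements of [G] commuting with [A] form a subgroup. Equivariance thus becomes a finite test
    on two generators. *)
Lemma Ghom_generated n m (rho : glat gT n) (sigma : glat gT m) (X : {set gT}) A :
  is_Glattice G rho -> is_Glattice G sigma -> G = <<X>>%G ->
  (forall g, g \in X -> A *m rho g = sigma g *m A) -> Ghom G rho sigma A.
Proof.
move=> [rho1 rhoM] [sig1 sigM] defG AX.
pose S := [set g in G | A *m rho g == sigma g *m A].
have gS : group_set S.
  apply/group_setP; split; first by rewrite inE group1 rho1 sig1 mulmx1 mul1mx eqxx.
  move=> g h; rewrite !inE => /andP[gG /eqP Ag] /andP[hG /eqP Ah].
  by rewrite groupM //= rhoM // sigM // mulmxA Ag -mulmxA Ah mulmxA eqxx.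
have sGS : G \subset Group gS.
  rewrite {1}defG gen_subG; apply/subsetP => g gX.
  by rewrite inE AX // eqxx defG mem_gen.
by move=> g /(subsetP sGS); rewrite inE => /andP[_ /eqP].
Qed.

Lemma dsum_Glattice n m (rho : glat gT n) (sigma : glat gT m) :
  is_Glattice G rho -> is_Glattice G sigma -> is_Glattice G (dsum rho sigma).
Proof.
move=> [rho1 rhoM] [sig1 sigM]; split=> [|g h gG hG].
  by rewrite /dsum rho1 sig1 -scalar_mx_block.
by rewrite /dsum rhoM // sigM // mulmx_block !mulmx0 !mul0mx ?(addr0, add0r).
Qed.

(** * Permutation lattices and flabbiness *)

Section PermLat.
Variable K : {group gT}.
Local Notation crep := (@enum_val _ (mem (lcosets K G))).

Lemma crepP (j : 'I_#|lcosets K G|) g : g \in G -> lcoset (crep j) g \in lcosets K G.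
Proof.
move=> gG; have /lcosetsP[x xG ->] := enum_valP j.
by apply/lcosetsP; exists (g * x)%g; rewrite ?groupM // !lcosetE lcosetM.
Qed.

(** The action on coset indices; the default [j] can only be returned for [g] outside [G]. *)
Definition cact g (j : 'I_#|lcosets K G|) : 'I_#|lcosets K G| :=
  enum_rank_in (enum_valP j) (lcoset (crep j) g).

Lemma crep_cact g j : g \in G -> crep (cact g j) = lcoset (crep j) g.
Proof. by move=> gG; rewrite enum_rankK_in // crepP. Qed.

Lemma cactM g h j : g \in G -> h \in G -> cact (g * h)%g j = cact g (cact h j).
Proof.
move=> gG hG; apply: enum_val_inj; rewrite !crep_cact ?groupM //.
by rewrite !lcosetE lcosetM.
Qed.

Lemma cact1 j : cact 1%g j = j.
Proof. by apply: enum_val_inj; rewrite crep_cact // lcosetE mul1g. Qed.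

Lemma perm_latE g i j : g \in G -> perm_lat G K g i j = (i == cact g j)%:R.
Proof.
move=> gG; rewrite mxE -crep_cact // eq_sym.
by rewrite (inj_eq (@enum_val_inj _ _)).
Qed.

Lemma perm_lat_Glattice : is_Glattice G (perm_lat G K).
Proof.
split=> [|g h gG hG]; first by apply/matrixP=> i j; rewrite perm_latE // cact1 mxE.
apply/matrixP=> i j; rewrite perm_latE ?groupM // mxE (bigD1 (cact h j)) //=.
rewrite big1 => [|k nkj]; last by rewrite (perm_latE k) // (negPf nkj) mulr0.
by rewrite !perm_latE // eqxx mulr1 addr0 cactM.
Qed.

(** Permutation matrices are orthogonal, so a permutation lattice is its own dual. This is what
    keeps [P] in place when the resolution is dualized. *)
Lemma tr_perm_lat g : g \in G -> (perm_lat G K g)^T = perm_lat G K g^-1%g.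
Proof.
move=> gG; apply/matrixP=> i j; rewrite mxE !perm_latE ?groupV //; congr (nat_of_bool _)%:R.
apply/idP/idP => /eqP ->; first by rewrite -cactM ?groupV // mulVg cact1.
by rewrite -cactM ?groupV // mulgV cact1.
Qed.

End PermLat.

Lemma psum_Glattice s : is_Glattice G (psum G s).
Proof.
elim: s => [|K s IH]; first by split=> [|g h _ _] /=; rewrite [RHS]flatmx0.
exact: dsum_Glattice (perm_lat_Glattice K) IH.
Qed.

Lemma tr_psum s g : g \in G -> (psum G s g)^T = psum G s g^-1%g.
Proof.
move=> gG; elim: s => [|K s IH] /=; first by rewrite trmx0.
by rewrite /dsum tr_block_mx !trmx0 tr_perm_lat // IH.
Qed.

(* Permutation lattices are flabby: an element killed by the norm of L has
   coordinate sum 0 on each L-orbit, and every basis vector is a translate of a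
   chosen orbit representative. *)
Lemma perm_lat_flabby K : flabby G (perm_lat G K).
Proof.
move=> L /subsetP sLG v Nv0.
have LG g : g \in L -> g \in G by exact: sLG.
pose n := #|lcosets K G|.
pose r (j i : 'I_n) := [exists h in L, i == cact h j].
have rrefl j : r j j by apply/existsP; exists 1%g; rewrite group1 cact1 eqxx.
have rsym i j : r i j -> r j i.
  case/existsP=> h /andP[hL /eqP ->]; apply/existsP; exists h^-1%g.
  by rewrite groupV hL -cactM ?groupV ?LG // mulVg cact1 eqxx.
have rtrans i j k : r i j -> r j k -> r i k.
  case/existsP=> h /andP[hL /eqP ->] /existsP[g /andP[gL /eqP ->]].
  by apply/existsP; exists (g * h)%g; rewrite groupM // cactM ?LG // eqxx.
(* [c j] is the chosen representative of the [L]-orbit of [j]: orbit-equal indices have equal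
   predicates, hence the same [pick]. *)
pose c j := odflt j [pick i | r j i].
have rc j : r j (c j) by rewrite /c; case: pickP => [//|/(_ j)]; rewrite rrefl.
have rE i j : r i j -> r i =1 r j.
  by move=> rij k; apply/idP/idP; [apply: rtrans; apply: rsym | apply: rtrans].
have cE i j : r i j -> c i = c j.
  move=> rij; rewrite /c (eq_pick (rE _ _ rij)).
  by case: pickP => // /(_ j); rewrite rrefl.
pose H j := odflt 1%g [pick h in L | j == cact h (c j)].
have HP j : (H j \in L) /\ j = cact (H j) (c j).
  rewrite /H; case: pickP => [h /andP[hL /eqP]//|no].
  have /existsP[h /andP[hL jh]] := rsym _ _ (rc j).
  by have := no h; rewrite /= hL jh.
pose e (j : 'I_n) : 'cV[int]_n := delta_mx j 0.
have actE g j : g \in G -> perm_lat G K g *m e j = e (cact g j).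
  move=> gG; apply/matrixP=> i k; rewrite ord1 -colE mxE perm_latE // mxE.
  by rewrite eqxx andbT.
(* The vector at [h] collects the coordinates of those [j] which [h] was chosen to reach, so that
   the total is the sum of the [v j] times ([e j] - [e (c j)]). *)
exists (fun h => \sum_(j | H j == h) v j 0 *: e (c j)).
have ve : v = \sum_j v j 0 *: e j.
  apply/matrixP=> i k; rewrite ord1 summxE (bigD1 i) //= big1 => [|j nji].
    by rewrite !mxE !eqxx mulr1 addr0.
  by rewrite !mxE eq_sym (negPf nji) mulr0.
have -> : \sum_(h in L) (perm_lat G K h - 1%:M) *m
            (\sum_(j | H j == h) v j 0 *: e (c j)) =
          \sum_j v j 0 *: (e j - e (c j)).
  rewrite (partition_big H (mem L)) /=; last by move=> j _; case: (HP j).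
  apply: eq_bigr => h hL; rewrite mulmx_sumr; apply: eq_bigr => j /eqP Hj.
  rewrite -scalemxAr mulmxBl mul1mx actE ?LG //; congr (_ *: (e _ - _)).
  by rewrite -Hj; case: (HP j).
under eq_bigr do rewrite scalerBr.
rewrite sumrB -ve; suff -> : \sum_j v j 0 *: e (c j) = 0 by rewrite subr0.
apply/matrixP=> i k; rewrite ord1 summxE mxE.
have [ci | nci] := eqVneq (c i) i; last first.
  apply: big1 => j _; rewrite !mxE eqxx andbT; case: eqP => [ij|]; last by rewrite mulr0.
  by case/eqP: nci; rewrite [in RHS]ij; apply: cE; rewrite ij; apply/rsym/rc.
(* At a representative [i], the norm of [v] has as coordinate the orbit sum times the order [st] of
   the stabilizer of [i] in [L]; as [st] is positive, the orbit sum vanishes. *)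
have /matrixP/(_ i 0) := Nv0; rewrite {1}ve mulmx_sumr summxE mxE.
pose st := #|[set h in L | i == cact h i]|.
suff -> : \sum_j ((\sum_(h in L) perm_lat G K h) *m (v j 0 *: e j)) i 0 =
          (\sum_j (v j 0 *: e (c j)) i 0) *+ st.
  have st_gt0 : (0 < st)%N.
    by apply/card_gt0P; exists 1%g; rewrite inE group1 cact1 eqxx.
  by move/eqP; rewrite mulrn_eq0 eqn0Ngt st_gt0 => /eqP.
rewrite -sumrMnl; apply: eq_bigr => j _.
rewrite -scalemxAr mulmx_suml !mxE eqxx andbT summxE.
have -> : \sum_(h in L) (perm_lat G K h *m e j) i 0 = #|[set h in L | i == cact h j]|%:R.
  rewrite -[X in _ = X%:R]sum1_card natr_sum big_mkcond [RHS]big_mkcond /=; apply: eq_bigr => h _.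
  rewrite inE; case: ifP => //= hL; rewrite actE ?LG // mxE eqxx andbT.
  by case: eqP.
have [ij | nij] := eqVneq i (c j); last first.
  rewrite mulr0 mul0rn; suff -> : [set h in L | i == cact h j] = set0 by rewrite cards0 mulr0.
  apply/setP=> h; rewrite !inE; apply/negP => /andP[hL ih]; case/eqP: nij.
  by rewrite -ci; symmetry; apply: cE; apply/existsP; exists h; rewrite hL.
rewrite mulr1 -[RHS]mulr_natr; congr (_ * _%:R).
have [] := HP j; rewrite -ij; move: (H j) => t tL jt.
(* The elements taking [j] to [i] form a translate of the stabilizer of [i]. *)
have -> : [set h in L | i == cact h j] = [set h * t^-1 | h in [set h in L | i == cact h i]]%g.
  apply/setP=> h; apply/idP/imsetP => [|[g]]; rewrite !inE.
    case/andP=> hL ih; exists (h * t)%g; last by rewrite mulgK.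
    by rewrite inE groupM //= cactM ?LG // -jt.
  case/andP=> gL ig ->; rewrite groupM ?groupV //= cactM ?groupV ?LG //.
  suff -> : cact t^-1%g j = i by [].
  by rewrite [in LHS]jt -cactM ?groupV ?LG // mulVg cact1.
by rewrite card_imset //; apply: mulIg.
Qed.

(** Vanishing passes to direct summands: push [v] forward by [A], decompose it there, and pull the
    decomposition back by the retraction [B]. *)
Lemma tateHm1_trivial_summand n m (rho : glat gT n) (sigma : glat gT m) (L : {group gT})
    (A : 'M[int]_(m, n)) (B : 'M[int]_(n, m)) :
  L \subset G -> Ghom G rho sigma A -> Ghom G sigma rho B -> B *m A = 1%:M ->
  tateHm1_trivial sigma L -> tateHm1_trivial rho L.
Proof.
move=> /subsetP sLG AG BG BA tS v Nv0.
have [|w Aw] := tS (A *m v).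
  rewrite mulmxA mulmx_suml (eq_bigr (fun h => A *m rho h)).
    by rewrite -mulmx_sumr -mulmxA Nv0 mulmx0.
  by move=> h hL; rewrite AG ?sLG.
exists (fun h => B *m w h); rewrite -[LHS]mul1mx -{1}BA -mulmxA Aw mulmx_sumr.
apply: eq_bigr => h hL; rewrite !mulmxA; congr (_ *m _).
by rewrite mulmxBr mulmxBl mulmx1 mul1mx BG ?sLG.
Qed.

Lemma dsum_flabby n m (rho : glat gT n) (sigma : glat gT m) :
  flabby G rho -> flabby G sigma -> flabby G (dsum rho sigma).
Proof.
move=> fr fs L sLG v.
have -> : \sum_(h in L) dsum rho sigma h =
          block_mx (\sum_(h in L) rho h) 0 0 (\sum_(h in L) sigma h).
  elim/big_rec3: _ => [|h x y z _ ->]; first by rewrite block_mx0.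
  by rewrite /dsum add_block_mx !addr0.
rewrite -[v]vsubmxK mul_block_col !mul0mx addr0 add0r => E.
have := congr1 usubmx E; have := congr1 dsubmx E; rewrite col_mxKd col_mxKu !linear0.
move=> /(fs L sLG)[w' ->] /(fr L sLG)[w ->].
exists (fun h => col_mx (w h) (w' h)).
elim/big_rec3: _ => [|h x y z hL <-]; first by rewrite col_mx0.
rewrite /dsum (scalar_mx_block _ _ 1) opp_block_mx add_block_mx !oppr0 !addr0.
by rewrite mul_block_col !mul0mx addr0 add0r add_col_mx.
Qed.

Lemma psum_flabby s : flabby G (psum G s).
Proof.
elim: s => [|K s IH]; last by apply: dsum_flabby IH; apply: perm_lat_flabby.
move=> L _ v _; by exists (fun _ => 0); rewrite [v]flatmx0 [RHS]flatmx0.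
Qed.

(** A stably permutation lattice is a direct summand of a permutation lattice, through the
    restriction of the isomorphism and the projection of its inverse. *)
Lemma stably_perm_flabby n (rho : glat gT n) : stably_perm G rho -> flabby G rho.
Proof.
case=> s1 [s2 [A [B [AG BA AB]]]] L sLG.
have BG : Ghom G (psum G s2) (dsum rho (psum G s1)) B.
  move=> g gG; rewrite -[B *m _]mulmx1 -AB !mulmxA -(mulmxA B) -AG //.
  by rewrite !mulmxA BA mul1mx.
apply: (@tateHm1_trivial_summand _ _ _ _ _ (A *m col_mx 1%:M 0) (row_mx 1%:M 0 *m B) sLG);
  last exact: (@psum_flabby s2 L sLG).
- move=> g gG; rewrite mulmxA -AG // -!mulmxA; congr (_ *m _).
  by rewrite /dsum mul_block_col mul_col_mx !mulmx0 !mul0mx !addr0 mulmx1 mul1mx.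
- move=> g gG; rewrite -mulmxA BG // !mulmxA; congr (_ *m _).
  by rewrite /dsum mul_row_block mul_mx_row !mulmx0 !mul0mx !addr0 mulmx1 mul1mx.
- by rewrite mulmxA -(mulmxA _ B) BA mulmx1 mul_row_col mulmx0 addr0 mulmx1.
Qed.

End Lattice.

(** * The dual resolution *)

Lemma mulmx1C_eq (m n : nat) (A : 'M[int]_(m, n)) (B : 'M[int]_(n, m)) :
  m = n -> A *m B = 1%:M -> B *m A = 1%:M.
Proof. by move=> e; case: _ / e in A B *; apply: mulmx1C. Qed.

(* By the Smith normal form, a split surjection over Z has a free kernel. *)
Lemma split_surjection k p f (T : 'M[int]_(k, p)) (W : 'M[int]_(p, k)) :
  p = (k + f)%N -> T *m W = 1%:M ->
  exists (W' : 'M[int]_(p, k)) (N : 'M[int]_(p, f)) (X : 'M[int]_(f, p)),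
    [/\ T *m W' = 1%:M, T *m N = 0, X *m N = 1%:M & W' *m T + N *m X = 1%:M].
Proof.
move=> ep; move: T W; rewrite {p}ep => T W TW.
have [L uL [R uR [d _ TE]]] := int_Smith_normal_form T.
set D := \matrix_(i, j) _ in TE.
pose Dl := lsubmx D.
have DE : D = row_mx Dl 0.
  rewrite -[D]hsubmxK; congr row_mx; apply/matrixP=> i j; rewrite !mxE /=.
  by case: eqP => // ij; have := ltn_ord i; rewrite ij ltnNge leq_addr.
(* The right inverse [W] of [T] makes the diagonal block right invertible over Z, hence
   invertible. *)
have uDl : Dl \in unitmx.
  have : L *m (Dl *m (usubmx R *m W)) = 1%:M.
    rewrite -TW TE DE -{2}[R]vsubmxK -!mulmxA; congr (_ *m _).
    by rewrite mul_col_mx mul_row_col mul0mx addr0.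
  move/mulmx1C; rewrite -mulmxA => /mulmx1_unit[]; by [].
pose V := invmx R.
have RV : R *m V = 1%:M by rewrite mulmxV.
have VR : V *m R = 1%:M by rewrite mulVmx.
pose LD := L *m Dl.
have uLD : LD \in unitmx by rewrite unitmx_mul uL.
have TV : T *m V = row_mx LD 0.
  by rewrite TE -mulmxA RV mulmx1 DE mul_mx_row mulmx0.
have TVl : T *m lsubmx V = LD.
  by move/(congr1 lsubmx): TV; rewrite row_mxKl -{1}[V]hsubmxK mul_mx_row row_mxKl.
have TVr : T *m rsubmx V = 0.
  by move/(congr1 rsubmx): TV; rewrite row_mxKr -{1}[V]hsubmxK mul_mx_row row_mxKr.
have TR : T = LD *m usubmx R.
  rewrite -[LHS]mulmx1 -VR mulmxA TV -{1}[R]vsubmxK mul_row_col mul0mx addr0 //.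
(* In the basis given by the columns of [V], the inverse of [R], the last [f] vectors span the
   kernel of [T]. *)
exists (lsubmx V *m invmx LD), (rsubmx V), (dsubmx R); split.
- by rewrite mulmxA TVl mulmxV.
- exact: TVr.
- have := RV; rewrite -{1}[R]vsubmxK -{1}[V]hsubmxK mul_col_row (scalar_mx_block k f 1).
  by case/eq_block_mx.
- rewrite {1}TR mulmxA mulmxKV // -VR.
  by rewrite -{3}[V]hsubmxK -{3}[R]vsubmxK mul_row_col.
Qed.

Section Quotient.
Variables (gT : finGroupType) (G : {group gT}).

(** The hypothesis on [b *m s *m Pi] says that [b] factors through the quotient [Pi]. The induced
    map [b *m s] has the right inverse [Pi *m c], and equal ranks make it invertible. *)
Lemma Giso_quotient n m l (rho : glat gT n) (sigma : glat gT m) (tau : glat gT l)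
    (Pi : 'M[int]_(m, n)) (s : 'M[int]_(n, m)) (b : 'M[int]_(l, n)) (c : 'M[int]_(n, l)) :
  m = l -> Ghom G rho sigma Pi -> Pi *m s = 1%:M ->
  Ghom G rho tau b -> b *m s *m Pi = b -> b *m c = 1%:M -> Giso G sigma tau.
Proof.
move=> ml PiG Pis bG bsPi bc.
have bsc : (b *m s) *m (Pi *m c) = 1%:M by rewrite mulmxA bsPi.
exists (b *m s), (Pi *m c); split=> //; last by apply: mulmx1C_eq bsc.
move=> g gG; rewrite -[sigma g]mulmx1 -Pis (mulmxA (sigma g)) -PiG //.
by rewrite !mulmxA bsPi bG // -!mulmxA.
Qed.

Section AugIdeal.
Variables (K : {group gT}) (k : nat) (tau : glat gT k).
Variable B : 'M[int]_(#|lcosets K G|, k).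
Hypothesis augB : aug_ideal G K tau B.

Let n := #|lcosets K G|.

Lemma aug_ideal_inj p (X Y : 'M[int]_(k, p)) : B *m X = B *m Y -> X = Y.
Proof.
have [_ _ Binj _] := augB; move/eqP; rewrite -subr_eq0 -mulmxBr => /eqP BXY.
apply/eqP; rewrite -subr_eq0; apply/eqP/matrixP=> i j.
have /Binj : B *m col j (X - Y) = 0 by rewrite colE mulmxA BXY mul0mx.
by move/matrixP/(_ i 0); rewrite !mxE.
Qed.

Lemma aug_ideal_lift p (Q : 'M[int]_(n, p)) :
  (forall j, \sum_i Q i j = 0) -> exists T, Q = B *m T.
Proof.
have [_ _ _ Bim] := augB => Q0.
have /fin_all_exists[w Qw] j : exists w, col j Q = B *m w.
  by apply/Bim; apply: etrans (Q0 j); apply: eq_bigr => i _; rewrite mxE.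
exists (\matrix_(i, j) w j i 0); apply/matrixP=> i j.
by move: (Qw j) => /matrixP/(_ i 0); rewrite !mxE => ->; apply: eq_bigr => l _; rewrite mxE.
Qed.

Lemma aug_ideal_sum0 j : \sum_i B i j = 0.
Proof.
have [_ _ _ Bim] := augB; have -> : \sum_i B i j = \sum_i col j B i 0.
  by apply: eq_bigr => i _; rewrite mxE.
by apply/Bim; exists (delta_mx j 0); rewrite colE.
Qed.

(** With [u] the augmentation, [1 - e0 u] projects onto its kernel along the base point [e0];
    lifting it through [B] gives the retraction. *)
Lemma aug_ideal_retract (x0 : 'I_n) :
  exists2 W : 'M[int]_(k, n), W *m B = 1%:M & n = k.+1.
Proof.
pose e0 : 'cV[int]_n := delta_mx x0 0; pose u : 'rV[int]_n := const_mx 1.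
have uE p (Q : 'M[int]_(n, p)) j : (u *m Q) 0 j = \sum_i Q i j.
  by rewrite mxE; apply: eq_bigr => i _; rewrite mxE mul1r.
have ue0 : u *m e0 = 1%:M.
  apply/matrixP=> i j; rewrite !ord1 uE (bigD1 x0) //= big1 ?mxE ?eqxx ?addr0 //.
  by move=> l nl; rewrite mxE (negPf nl).
have uB : u *m B = 0 by apply/matrixP=> i j; rewrite !ord1 uE aug_ideal_sum0 mxE.
have [|W WE] := @aug_ideal_lift _ (1%:M - e0 *m u).
  by move=> j; rewrite -uE mulmxBr mulmx1 mulmxA ue0 mul1mx subrr mxE.
have WB : W *m B = 1%:M.
  by apply: aug_ideal_inj; rewrite mulmxA -WE mulmxBl mul1mx -mulmxA uB mulmx0 subr0 mulmx1.
have We0 : W *m e0 = 0.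
  by apply: aug_ideal_inj; rewrite mulmxA -WE mulmxBl mul1mx -mulmxA ue0 mulmx1 subrr mulmx0.
exists W => //.
have BW : row_mx B e0 *m col_mx W u = 1%:M by rewrite mul_row_col -WE subrK.
have WB' : col_mx W u *m row_mx B e0 = 1%:M.
  by rewrite mul_col_row WB We0 uB ue0 -scalar_mx_block.
(* One-sided inverses on both sides bound the two dimensions by each other. *)
apply/eqP; rewrite eqn_leq -addn1 (mulmx1_min BW); exact: (mulmx1_min WB').
Qed.

(* The resolution is dual to 0 -> ker Q -> P -> I -> 0. *)
Lemma dual_resolution p f (P : glat gT p) (Q : 'M[int]_(n, p)) (x0 : 'I_n) :
  is_Glattice G P -> is_perm G P -> (forall g, g \in G -> (P g)^T = P g^-1%g) ->
  p = (k + f)%N -> Ghom G P (perm_lat G K) Q ->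
  (forall j, \sum_i Q i j = 0) ->
  (forall i, exists u : 'cV[int]_p, delta_mx i 0 - delta_mx x0 0 = Q *m u) ->
  exists (Fl : glat gT f) (i : 'M[int]_(p, k)) (pi : 'M[int]_(f, p)) (s : 'M[int]_(p, f)),
    [/\ is_Glattice G Fl, Ghom G (dual_lat tau) P i, Ghom G P Fl pi, short_exact i pi &
        pi *m s = 1%:M /\ forall l (b : 'M[int]_(l, p)), b *m Q^T = 0 -> b *m s *m pi = b].
Proof.
move=> [P1 PM] permP trP pE QG Q0 Qonto.
have [[tau1 tauM] BG _ _] := augB.
have [W0 W0B _] := aug_ideal_retract x0.
have [T QE] := aug_ideal_lift Q0.
have TG : Ghom G P tau T.
  by move=> g gG; apply: aug_ideal_inj; rewrite !mulmxA -QE QG // BG // -mulmxA -QE.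
have /fin_all_exists[U QU] := Qonto.
(* The columns [U] lift the differences from the base point, so [Q] times their matrix is the
   projection [1 - e0 u], which fixes the image of [B]. *)
have QB : Q *m ((\matrix_(i, j) U j i 0) *m B) = B.
  apply/matrixP=> i j; rewrite mulmxA.
  have -> : Q *m (\matrix_(i, j) U j i 0) = 1%:M - (delta_mx x0 0 : 'cV_n) *m (const_mx 1 : 'rV_n).
    apply/matrixP=> a c; move: (QU c) => /matrixP/(_ a 0).
    rewrite !mxE big_ord1 !mxE !eqxx !andbT mulr1 => ->.
    by apply: eq_bigr => l _; rewrite mxE.
  rewrite mulmxBl mul1mx -mulmxA; suff -> : const_mx 1 *m B = 0 :> 'rV_k.
    by rewrite mulmx0 subr0.
  apply/matrixP=> a c; rewrite !mxE -[RHS](aug_ideal_sum0 c).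
  by apply: eq_bigr => l _; rewrite mxE mul1r.
have TW : T *m ((\matrix_(i, j) U j i 0) *m B) = 1%:M.
  by apply: aug_ideal_inj; rewrite mulmxA -QE QB mulmx1.
have [W [N [X [TW' TN XN WTNX]]]] := split_surjection pE TW.
have WTNX' : T^T *m W^T + X^T *m N^T = 1%:M.
  by rewrite -!trmx_mul -linearD WTNX /= trmx1.
have NX' : N^T *m X^T = 1%:M by rewrite -trmx_mul XN trmx1.
have NT' : N^T *m T^T = 0 by rewrite -trmx_mul TN trmx0.
have TG' : Ghom G (dual_lat tau) P T^T.
  move=> g gG; rewrite /dual_lat -trmx_mul -TG ?groupV // trmx_mul trP ?groupV //.
  by rewrite invgK.
(* The columns of [N] form a basis of ker [Q]; [Fl] is the dual action on it, written with the
   splitting [X]. *)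
pose Fl g := N^T *m P g *m X^T.
have piG : Ghom G P Fl N^T.
  move=> g gG; rewrite /Fl -mulmxA.
  have -> : X^T *m N^T = 1%:M - T^T *m W^T by rewrite -WTNX' addrC addKr.
  rewrite mulmxBr mulmx1 -[N^T *m P g *m _]mulmxA (mulmxA (P g)) -TG' //.
  by rewrite -!mulmxA (mulmxA N^T) NT' mul0mx subr0.
exists Fl, T^T, N^T, X^T; split=> //.
- split=> [|g h gG hG]; first by rewrite /Fl P1 mulmx1.
  by rewrite {1}/Fl PM // mulmxA piG // /Fl -!mulmxA.
- split=> [w Tw0|u|v].
  + by rewrite -[w]mul1mx -trmx1 -TW' trmx_mul -mulmxA Tw0 mulmx0.
  + by exists (X^T *m u); rewrite mulmxA NX' mul1mx.
  + split=> [Nv0|[w ->]]; last by rewrite mulmxA NT' mul0mx.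
    exists (W^T *m v); rewrite -[LHS]mul1mx -WTNX' mulmxDl -!mulmxA Nv0 mulmx0 addr0 //.
- split=> // l b bQ0.
  (* Since [Q = B *m T], the transpose of [Q] is that of [T] followed by that of [B]; the latter
     cancels because [B] has the left inverse [W0]. *)
  have bT0 : b *m T^T = 0.
    have : b *m T^T *m (B^T *m W0^T) = 0.
      by rewrite mulmxA -[b *m T^T *m B^T]mulmxA -trmx_mul -QE bQ0 mul0mx.
    by rewrite -trmx_mul W0B trmx1 mulmx1.
  rewrite -mulmxA; have -> : X^T *m N^T = 1%:M - T^T *m W^T by rewrite -WTNX' addrC addKr.
  by rewrite mulmxBr mulmx1 mulmxA bT0 mul0mx subr0.
Qed.

End AugIdeal.
End Quotient.

(** * Lattices with a numbered basis *)

Section Labelled.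
Variables (gT : finGroupType) (G : {group gT}) (g : bool -> gT).
Hypothesis gG : forall t, g t \in G.
Hypothesis defG : G = <<[set g true; g false]>>%G.

(** The permutations act on plain natural numbers, so that they can be lookup tables and matrix
    identities can be settled by computation. *)
Definition labelled n (rho : glat gT n) N (p : bool -> nat -> nat) (lab : 'I_n -> 'I_N) :=
  [/\ bijective lab, forall t k, (k < N)%N -> (p t k < N)%N &
      forall t i j, rho (g t) i j = ((lab i : nat) == p t (lab j))%:R].

Definition pcat N (p q : bool -> nat -> nat) t k :=
  if (k < N)%N then p t k else (N + q t (k - N))%N.

Definition labcat n m N M (lab : 'I_n -> 'I_N) (lab' : 'I_m -> 'I_M) (i : 'I_(n + m)) :=
  match split i with inl j => lshift M (lab j) | inr j => rshift N (lab' j) end.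

Lemma labcatl n m N M (lab : 'I_n -> 'I_N) (lab' : 'I_m -> 'I_M) j :
  labcat lab lab' (lshift m j) = lshift M (lab j).
Proof. by rewrite /labcat; case: split_ordP => k /eqP; rewrite eq_shift // => /eqP ->. Qed.

Lemma labcatr n m N M (lab : 'I_n -> 'I_N) (lab' : 'I_m -> 'I_M) j :
  labcat lab lab' (rshift n j) = rshift N (lab' j).
Proof. by rewrite /labcat; case: split_ordP => k /eqP; rewrite eq_shift // => /eqP ->. Qed.

Lemma labelled_dsum n m (rho : glat gT n) (sigma : glat gT m) N M p q
    (lab : 'I_n -> 'I_N) (lab' : 'I_m -> 'I_M) :
  labelled rho p lab -> labelled sigma q lab' ->
  labelled (dsum rho sigma) (pcat N p q) (labcat lab lab').
Proof.
move=> [[f labK fK] pN rhoE] [[f' labK' fK'] qM sigE]; split.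
- exists (labcat f f') => i; case: (split_ordP i) => j ->.
  + by rewrite !labcatl labK.
  + by rewrite !labcatr labK'.
  + by rewrite !labcatl fK.
  + by rewrite !labcatr fK'.
- move=> t k kNM; rewrite /pcat; case: (ltnP k N) => kN; first by rewrite ltn_addr ?pN.
  by rewrite ltn_add2l qM // ltn_subLR.
- move=> t i j; rewrite /dsum /pcat.
  case: (split_ordP i) => i' ->; case: (split_ordP j) => j' ->.
  + by rewrite block_mxEul !labcatl /= ltn_ord rhoE.
  + rewrite block_mxEur labcatl labcatr /= ltnNge leq_addr /= mxE.
    by rewrite ltn_eqF // ltn_addr.
  + rewrite block_mxEdl labcatl labcatr /= ltn_ord mxE.
    by rewrite gtn_eqF // ltn_addr ?pN.
  + by rewrite block_mxEdr !labcatr /= ltnNge leq_addr /= addKn eqn_add2l sigE.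
Qed.

Lemma labelled_psum0 p : labelled (psum G [::]) p (id : 'I_0 -> 'I_0).
Proof. by split=> [|//|t []//]; exists id. Qed.

Definition relab m n M N (lab' : 'I_m -> 'I_M) (lab : 'I_n -> 'I_N) (b : nat -> nat -> int) :=
  \matrix_(i, j) b (lab' i) (lab j).

Definition basis n (j : 'I_n) : 'cV[int]_n := delta_mx j 0.

Lemma mulmx_basis n m (A : 'M[int]_(m, n)) j : A *m basis j = col j A.
Proof. by rewrite colE. Qed.

Lemma sum_label n N (lab : 'I_n -> 'I_N) (F : nat -> int) :
  bijective lab -> \sum_k F (lab k) = \sum_(0 <= k < N) F k.
Proof. by move=> lab_bij; rewrite big_mkord [RHS](reindex lab) //; apply: onW_bij. Qed.

Section OneLattice.
Variables (n : nat) (rho : glat gT n) (N : nat) (p : bool -> nat -> nat) (lab : 'I_n -> 'I_N).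
Hypotheses (latR : is_Glattice G rho) (labR : labelled rho p lab).

Lemma label_surj k : (k < N)%N -> exists j, lab j = k :> nat.
Proof. by case: labR => [[f _ fK] _ _] kN; exists (f (Ordinal kN)); rewrite fK. Qed.

Lemma label_inj : injective lab.
Proof. by case: labR => /bij_inj. Qed.

Lemma labelled_basis t i j : lab i = p t (lab j) :> nat -> rho (g t) *m basis j = basis i.
Proof.
case: labR => _ _ rhoE ij; apply/matrixP=> k l; rewrite ord1 mulmx_basis !mxE rhoE -ij.
by rewrite eqxx andbT (inj_eq val_inj) (inj_eq label_inj).
Qed.

(** Injectivity of the table comes for free from the invertibility of [rho (g t)]. *)
Lemma labelled_inj t i j : p t (lab i) = p t (lab j) -> i = j.
Proof.
case: labR => _ pN _ pij; have [rho1 rhoM] := latR.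
have [k kE] := label_surj (pN t _ (ltn_ord (lab j))).
have := congr1 (mulmx (rho (g t)^-1%g)) (etrans (labelled_basis (etrans kE (esym pij)))
                                          (esym (labelled_basis kE))).
rewrite !mulmxA -rhoM ?groupV // mulVg rho1 !mul1mx => /matrixP/(_ i 0).
by rewrite !mxE !eqxx /= andbT; case: eqP.
Qed.

(** Every number outside [base] is the image of a smaller one under a generator, as happens in
    breadth-first numbering. This supports strong induction along the orbits. *)
Definition reachable (base : seq nat) :=
  all (fun k => (k \in base) ||
         has (fun t => has (fun l => p t l == k) (iota 0 k)) [:: true; false]) (iota 0 N).

Lemma labelled_ind base (Pr : 'cV[int]_n -> Prop) :
  reachable base -> (forall j, (lab j : nat) \in base -> Pr (basis j)) ->
  (forall t v, Pr v -> Pr (rho (g t) *m v)) -> forall j, Pr (basis j).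
Proof.
move=> /allP reach Pbase Pstep.
suff IH k : forall j, lab j = k :> nat -> Pr (basis j) by move=> j; apply: IH (erefl _).
elim/ltn_ind: k => k IH j jk.
have := reach k; rewrite mem_iota -jk ltn_ord => /(_ isT)/orP[/Pbase // | /hasP[t _ /hasP[l]]].
rewrite mem_iota /= add0n => lj /eqP lE.
have [i iE] := label_surj (ltn_trans lj (ltn_ord (lab j))).
rewrite -(@labelled_basis t j i) ?iE //; apply/Pstep/(IH l) => //.
by rewrite -jk.
Qed.

End OneLattice.

Section TwoLattices.
Variables (n m : nat) (rho : glat gT n) (sigma : glat gT m) (N M : nat).
Variables (p q : bool -> nat -> nat) (lab : 'I_n -> 'I_N) (lab' : 'I_m -> 'I_M).
Hypotheses (latR : is_Glattice G rho) (labR : labelled rho p lab).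
Hypotheses (latS : is_Glattice G sigma) (labS : labelled sigma q lab').

Lemma relab_Ghom b :
  (forall t i j, (i < M)%N -> (j < N)%N -> b (q t i) (p t j) = b i j) ->
  Ghom G rho sigma (relab lab' lab b).
Proof.
move=> beq; apply: (@Ghom_generated _ G _ _ _ _ [set g true; g false]) => //.
suff H t : relab lab' lab b *m rho (g t) = sigma (g t) *m relab lab' lab b.
  by move=> h; rewrite !inE => /orP[] /eqP ->.
apply/matrixP=> i j; case: (labR) => _ pN rhoE; case: (labS) => [[f' _ f'K] qM sigE].
have [k kE] := label_surj labR (pN t _ (ltn_ord (lab j))).
rewrite mxE (bigD1 k) //= big1 ?addr0 => [|l nlk]; last first.
  by rewrite rhoE -kE (inj_eq val_inj) (inj_eq (label_inj labR)) (negPf nlk) mulr0.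
rewrite rhoE kE eqxx mulr1 mxE kE.
(* [q t] permutes the row numbers, being injective on a finite set; [h] is its inverse, and picks
   out the only nonzero term of the sum. *)
have qt_inj : injective (fun l : 'I_m => f' (Ordinal (qM t _ (ltn_ord (lab' l))))).
  move=> a c /(can_inj f'K) [] ac; exact: (labelled_inj latS labS ac).
have [h _ hK] := injF_bij qt_inj.
have iE : lab' i = q t (lab' (h i)) :> nat by rewrite -{1}(hK i) f'K.
rewrite mxE (bigD1 (h i)) //= big1 ?addr0 => [|l nl]; last first.
  rewrite sigE iE; case: eqP => [/(labelled_inj latS labS) E|]; last by rewrite mul0r.
  by rewrite E eqxx in nl.
by rewrite sigE iE eqxx mul1r mxE beq.
Qed.

Lemma relab_mul_col b (v : nat -> int) :
  relab lab' lab b *m (\col_j v (lab j)) = \col_i (\sum_(0 <= k < N) b (lab' i) k * v k).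
Proof.
apply/matrixP=> i k; rewrite !mxE; case: (labR) => lab_bij _ _.
rewrite -(sum_label (fun k => b (lab' i) k * v k) lab_bij).
by apply: eq_bigr => j _; rewrite !mxE.
Qed.

End TwoLattices.

End Labelled.

(** * The group PSL_2(F_8) *)

(* (a, b, c) stands for a + b x + c x^2 in F_2[x] / (x^3 + x + 1). *)
Definition F8 : Type := bool * bool * bool.

Definition add8 (x y : F8) : F8 :=
  let: (a, b, c) := x in let: (a', b', c') := y in (a (+) a', b (+) b', c (+) c').

(** [c3] and [c4] are the coefficients of x^3 and x^4, reduced by x^3 = x + 1 and x^4 = x^2 + x. *)
Definition mul8 (x y : F8) : F8 :=
  let: (a, b, c) := x in let: (a', b', c') := y in
  let c3 := (b && c') (+) (c && b') in let c4 := c && c' in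
  ((a && a') (+) c3, (a && b') (+) (b && a') (+) c3 (+) c4,
   (a && c') (+) (b && b') (+) (c && a') (+) c4).

Definition zero8 : F8 := (false, false, false).
Definition one8 : F8 := (true, false, false).
Definition bools := [:: false; true].
Definition enum8 : seq F8 :=
  [seq (x, c) | x <- [seq (a, b) | a <- bools, b <- bools], c <- bools].

(* (a, b, c, d) stands for the matrix with rows (a, b) and (c, d). *)
Definition M8 : Type := F8 * F8 * F8 * F8.

Definition mulM (x y : M8) : M8 :=
  let: (a, b, c, d) := x in let: (e, f, g, h) := y in
  (add8 (mul8 a e) (mul8 b g), add8 (mul8 a f) (mul8 b h),
   add8 (mul8 c e) (mul8 d g), add8 (mul8 c f) (mul8 d h)).

Definition oneM : M8 := (one8, zero8, zero8, one8).
(** The adjugate, without signs in characteristic 2; it is the inverse when the determinant is 1. *)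
Definition invM (x : M8) : M8 := let: (a, b, c, d) := x in (d, b, c, a).
Definition detM (x : M8) : F8 := let: (a, b, c, d) := x in add8 (mul8 a d) (mul8 b c).
Definition sl (x : M8) := detM x == one8.

Definition enumM : seq M8 :=
  [seq (x, y) | x <- [seq (x, y) | x <- [seq (x, y) | x <- enum8, y <- enum8], y <- enum8], y <- enum8].
Definition enumSL := [seq x <- enumM | sl x].

Lemma mem_enum8 x : x \in enum8.
Proof. by case: x => [[[] []] []]. Qed.

Lemma mem_enumSL x : (x \in enumSL) = sl x.
Proof.
rewrite mem_filter andb_idr // => _; case: x => [[[a b] c] d].
by do 3![apply: allpairs_f; last exact: mem_enum8]; apply: mem_enum8.
Qed.

(** * Interpretation of the concrete field and its matrices in [F] *)

Section Interpretation.
Variables (F : finFieldType) (z : F).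
Hypotheses (F2 : 1 + 1 = 0 :> F) (zE : z * z * z = z + 1).

Definition phi (x : F8) : F := let: (a, b, c) := x in a%:R + b%:R * z + c%:R * (z * z).

Lemma addrr2 (x : F) : x + x = 0.
Proof. by rewrite -[x]mul1r -mulrDl F2 mul0r. Qed.

Lemma natrX (a b : bool) : (a (+) b)%:R = a%:R + b%:R :> F.
Proof. by case: a b => [] []; rewrite ?addr0 ?add0r //= F2. Qed.

Lemma natrA (a b : bool) : (a && b)%:R = a%:R * b%:R :> F.
Proof. by case: a b => [] []; rewrite ?mulr0 ?mul0r ?mulr1. Qed.

Lemma phiD x y : phi (add8 x y) = phi x + phi y.
Proof. by case: x y => [[a b] c] [[a' b'] c'] /=; rewrite !natrX; ring. Qed.

Lemma phiM x y : phi (mul8 x y) = phi x * phi y.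
Proof.
case: x y => [[a b] c] [[a' b'] c'] /=; rewrite !(natrX, natrA).
have z4 : z * z * z * z = z * z + z by rewrite zE mulrDl mul1r.
move: (a%:R : F) (b%:R : F) (c%:R : F) (a'%:R : F) (b'%:R : F) (c'%:R : F).
move=> {}a {}b {}c {}a' {}b' {}c'.
transitivity (a * a' + (a * b' + b * a') * z + (a * c' + b * b' + c * a') * (z * z)
   + (b * c' + c * b') * (z * z * z) + c * c' * (z * z * z * z)); last by ring.
by rewrite z4 zE; ring.
Qed.

Lemma phi1 : phi one8 = 1.
Proof. by rewrite /phi /= !mul0r !addr0. Qed.

(** Every nonzero element of the model has an inverse, by exhaustion, and [phi] preserves
    products. *)
Lemma phi_eq0 x : phi x = 0 -> x = zero8.
Proof.
have /allP/(_ x (mem_enum8 x))/orP[/eqP // | /hasP[y _ /eqP xy] x0] :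
  all (fun x => (x == zero8) || has (fun y => mul8 x y == one8) enum8) enum8 by vm_compute.
by have := phiM x y; rewrite xy phi1 x0 mul0r => /eqP; rewrite oner_eq0.
Qed.

Lemma phi_inj : injective phi.
Proof.
move=> x y xy; have /phi_eq0 : phi (add8 x y) = 0 by rewrite phiD xy addrr2.
by case: x y {xy} => [[[] []] []] [[[] []] []].
Qed.

Lemma phi_surj : #|F| = 8%N -> forall y, exists x, phi x = y.
Proof.
move=> F_8 y; have [|f _ fK] := @inj_card_bij F8 F phi phi_inj _; last by exists (f y).
by rewrite F_8 !card_prod !card_bool.
Qed.

Definition mx8 (x : M8) : 'M[F]_2 :=
  let: (a, b, c, d) := x in
  \matrix_(i, j) phi (if i == 0 then if j == 0 then a else b else if j == 0 then c else d).

Lemma mx8M x y : mx8 (mulM x y) = mx8 x *m mx8 y.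
Proof.
case: x y => [[[a b] c] d] [[[e f] g] h]; apply/matrixP=> i j.
rewrite !mxE !big_ord_recl big_ord0 addr0 !mxE /=.
by case: i => [[|[|//]] ?]; case: j => [[|[|//]] ?]; rewrite /= !phiD !phiM.
Qed.

Lemma mx8_1 : mx8 oneM = 1%:M.
Proof.
apply/matrixP=> i j; rewrite !mxE.
by case: i => [[|[|//]] ?]; case: j => [[|[|//]] ?]; rewrite -!val_eqE /= !mul0r !addr0.
Qed.

Lemma mx8_inj : injective mx8.
Proof.
case=> [[[a b] c] d] [[[e f] g] h] /matrixP E.
have := E 0 0; have := E 0 1; have := E 1 0; have := E 1 1.
by rewrite !mxE /=; do 4!move/phi_inj->.
Qed.

Lemma det_mx8 x : \det (mx8 x) = phi (detM x).
Proof.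
case: x => [[[a b] c] d]; rewrite (expand_det_row _ 0) !big_ord_recl big_ord0.
rewrite /cofactor !det_mx11 !mxE /= !phiD !phiM expr0 expr1 mul1r addr0 mulN1r mulrN.
by congr (_ + _); apply/eqP; rewrite eq_sym -addr_eq0 addrr2.
Qed.

Lemma slE x : sl x = (\det (mx8 x) == 1).
Proof. by rewrite det_mx8 -phi1 (inj_eq phi_inj). Qed.

Lemma mx8_unit x : sl x -> mx8 x \in unitmx.
Proof. by rewrite slE unitmxE => /eqP ->; rewrite unitr1. Qed.

Lemma mx8_surj : #|F| = 8%N -> forall A, exists x, mx8 x = A.
Proof.
move=> F_8 A; have /fin_all_exists2[f _ fE] ij : exists2 x, true & phi x = A ij.1 ij.2.
  by have [x] := phi_surj F_8 (A ij.1 ij.2); exists x.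
exists (f (0, 0), f (0, 1), f (1, 0), f (1, 1)); apply/matrixP=> i j; rewrite !mxE.
by case: i => [[|[|//]] ?]; case: j => [[|[|//]] ?]; rewrite /= fE; congr (A _ _); apply: val_inj.
Qed.

(** The default value 1 is taken only for singular matrices, hence never on [sl]. *)
Definition gl8 (x : M8) : {'GL_2[F]} := insubd (1%g : {'GL_2[F]}) (mx8 x).

Lemma gl8K x : sl x -> GLval (gl8 x) = mx8 x.
Proof. by move/mx8_unit=> ux; apply: insubdK. Qed.

End Interpretation.

(** [PSL2] lives in a quotient type even when the center is trivial; this removes the quotient. *)
Lemma coset_trivg (gT : finGroupType) (Z : {group gT}) : (Z :=: 1 ->
  {morph coset Z : x y / x * y} /\ injective (coset Z))%g.
Proof.
move=> Z1; have nZ x : x \in ('N(Z))%g by rewrite Z1 norm1 inE.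
split=> [x y|x y E]; first exact: morphM.
apply/eqP; rewrite eq_mulgV1; suff : (x * y^-1)%g \in Z by rewrite Z1 => /set1P ->.
apply: coset_idr => //; rewrite morphM // morphV //=.
by apply/eqP; rewrite -eq_mulgV1 E.
Qed.

(** * The field with eight elements and its projective special linear group *)

Section Field8.
Variable F : finFieldType.
Hypothesis F_8 : #|F| = 8%N.

Lemma field8_char2 : 1 + 1 = 0 :> F.
Proof.
have /pcharf0 : 2 \in [pchar F] by apply: (@card_finPcharP F 2 3); rewrite // F_8.
by rewrite mulr2n.
Qed.

Lemma field8_root : exists z : F, z * z * z = z + 1.
Proof.
have [x] : exists x, x \notin [:: 0; 1 : F].
  apply/existsP; rewrite -negb_forall; apply: contraTN isT => /forallP all01.
  have : (#|F| <= size [:: 0; 1 : F]%R)%N.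
    by apply: leq_trans (card_size _); apply/subset_leq_card/subsetP => y _; apply: all01.
  by rewrite F_8.
rewrite !inE negb_or => /andP[x0 x1].
have : x ^+ 8 = x by rewrite -F_8 expf_card.
move/eqP; rewrite -subr_eq0.
(* The factorization of x^8 - x over F_2, corrected by a multiple of 2 to hold in any commutative
   ring. An [x] other than 0 and 1 is a root of one of the two cubics. *)
have -> : x ^+ 8 - x = x * (x - 1) * (x * x * x + x + 1) * (x * x * x + x * x + 1)
   - (1 + 1) * (x ^+ 5 - x ^+ 4) by ring.
rewrite field8_char2 mul0r subr0 !mulf_eq0 subr_eq0 (negPf x0) (negPf x1) /=.
case/orP=> /eqP E.
  exists x; apply/eqP; rewrite -subr_eq0; apply/eqP.
  have -> : x * x * x - (x + 1) = x * x * x + x + 1 - (1 + 1) * (x + 1) by ring.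
  by rewrite E field8_char2 mul0r subr0.
(* The shift by 1 turns a root of the second cubic into a root of the first. *)
exists (x + 1); apply/eqP; rewrite -subr_eq0; apply/eqP.
have -> : (x + 1) * (x + 1) * (x + 1) - (x + 1 + 1) =
  x * x * x + x * x + 1 + (1 + 1) * (x * x + x - 1) by ring.
by rewrite E field8_char2 mul0r addr0.
Qed.

Local Open Scope group_scope.

Definition central (x : M8) := all (fun y => mulM x y == mulM y x) enumSL.

Lemma central_one x : sl x -> central x -> x = oneM.
Proof.
rewrite -mem_enumSL => xS cx.
have /allP/(_ x xS) : all (fun x => central x ==> (x == oneM)) enumSL by vm_compute.
by rewrite cx => /eqP.
Qed.

(** The center is trivial by exhaustion, so [m] identifies the explicit matrices of determinant 1
    with [G], and later questions about [G] become finite checks on [enumSL]. *)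
Lemma PSL2_model : exists m : M8 -> coset_of 'Z(SL2 F),
  [/\ forall x y, sl x -> sl y -> sl (mulM x y) /\ m (mulM x y) = m x * m y,
      forall x y, sl x -> sl y -> m x = m y -> x = y &
      forall g, g \in PSL2 F <-> exists2 x, sl x & g = m x].
Proof.
have F2 := field8_char2; have [z zE] := field8_root.
have slM x y : sl x -> sl y -> sl (mulM x y).
  by rewrite !(slE F2 zE) (mx8M F2 zE) det_mulmx => /eqP -> /eqP ->; rewrite mulr1.
have glM x y : sl x -> sl y -> gl8 z (mulM x y) = gl8 z x * gl8 z y.
  move=> xS yS; apply: val_inj; rewrite -[LHS]/(GLval _) -[RHS]/(GLval _).
  by rewrite GL_MxE !(gl8K F2 zE) ?slM // (mx8M F2 zE).
have glSL x : sl x -> gl8 z x \in SL2 F.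
  by move=> xS; rewrite inE (gl8K F2 zE) // -(slE F2 zE).
have glS (A : {'GL_2[F]}) : A \in SL2 F -> exists2 x, sl x & A = gl8 z x.
  rewrite inE => dA; have [x xA] := mx8_surj F2 zE F_8 (GLval A).
  have xS : sl x by rewrite (slE F2 zE) xA.
  by exists x => //; apply: val_inj; rewrite -[LHS]/(GLval _) -[RHS]/(GLval _) (gl8K F2 zE).
have gl_inj x y : sl x -> sl y -> gl8 z x = gl8 z y -> x = y.
  by move=> xS yS /(congr1 (@GLval _ _)); rewrite !(gl8K F2 zE) // => /(mx8_inj F2 zE).
have Z1 : 'Z(SL2 F) = 1.
  apply/trivgP/subsetP=> A /centerP[AS cA]; have [x xS xA] := glS A AS.
  rewrite inE xA; suff -> : x = oneM.
    apply/eqP/val_inj; rewrite -[LHS]/(GLval _) (gl8K F2 zE) //.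
    by rewrite -[RHS]/(GLval _) GL_1E mx8_1.
  apply: central_one => //; apply/allP=> y; rewrite mem_enumSL => yS; apply/eqP/gl_inj.
  - exact: slM.
  - exact: slM.
  - have := cA _ (glSL y yS); rewrite xA => xyC.
    exact: etrans (glM x y xS yS) (etrans xyC (esym (glM y x yS xS))).
have [cosetM coset_inj] := coset_trivg (Z1 : 'Z(SL2 F)%G :=: 1).
exists (fun x => coset 'Z(SL2 F)%G (gl8 z x)); split.
- by move=> x y xS yS; split; [exact: slM | rewrite glM // cosetM].
- by move=> x y xS yS /coset_inj; apply: gl_inj.
- move=> g; split=> [/morphimP[A _ AS ->]|[x xS ->]]; last by rewrite mem_quotient ?glSL.
  by have [x xS ->] := glS A AS; exists x.
Qed.
End Field8.

(* Coset tables by breadth-first search *)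
Local Close Scope ring_scope.

(** The coordinate swap, and an upper triangular matrix with diagonal x, 1 + x^2, where x (1 + x^2)
    = 1. *)
Definition gen8 (t : bool) : M8 :=
  if t then (zero8, one8, one8, zero8)
  else ((false, true, false), one8, zero8, (true, false, true)).

Definition lmem (L : seq M8) (x y : M8) := mulM (invM x) y \in L.

Definition bfs_step L acc x := if has (fun r => lmem L r x) acc then acc else rcons acc x.

(** [acc] is both the result and the queue, read at position [i]; [n] is fuel. The order 504 of the
    group bounds the number of cosets, hence of reads. *)
Fixpoint bfs L n i acc :=
  if n is n'.+1 then
    if (i < size acc)%N then
      let r := nth oneM acc i in
      bfs L n' i.+1 (bfs_step L (bfs_step L acc (mulM (gen8 true) r)) (mulM (gen8 false) r))
    else acc
  else acc.

(* Representatives of the left cosets of L, in breadth first order from L. *)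
Definition reps L := bfs L 504 0 [:: oneM].

Definition coset_table L : seq (seq nat) :=
  let r := reps L in
  [seq [seq find (fun y => lmem L y (mulM (gen8 t) x)) r | x <- r] | t <- [:: true; false]].

(** The table of the generator [true] is stored first, whence the index [~~ t]. *)
Definition coset_act (tab : seq (seq nat)) (t : bool) (k : nat) :=
  nth 0 (nth [::] tab (~~ t)) k.

Definition slgroup (L : seq M8) :=
  [&& all sl L, uniq L, oneM \in L & all (fun x => all (fun y => mulM x y \in L) L) L].

(** A certificate: the representatives lie in distinct cosets, they exhaust the group because
    [N * size L] is its order, and the table agrees with left multiplication. *)
Definition coset_model L (N : nat) (tab : seq (seq nat)) :=
  let r := reps L in let rep := nth oneM r in
  [&& size r == N, N * size L == 504, all sl r,
      all (fun i => all (fun j => (i == j) || ~~ lmem L (rep i) (rep j)) (iota 0 N)) (iota 0 N) &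
      all (fun t => all (fun k => let k' := coset_act tab t k in
        (k' < N) && lmem L (rep k') (mulM (gen8 t) (rep k))) (iota 0 N)) [:: true; false]].

Lemma bfs_ind (Pr : pred M8) L n i acc :
  (forall t x, Pr x -> Pr (mulM (gen8 t) x)) -> all Pr acc -> all Pr (bfs L n i acc).
Proof.
move=> Pmul; have step_ind acc' x : all Pr acc' -> Pr x -> all Pr (bfs_step L acc' x).
  by move=> Pa Px; rewrite /bfs_step; case: ifP; rewrite // all_rcons Px.
elim: n i acc => //= n IH i acc Pacc; case: ifP => // ltia.
have Pi : Pr (nth oneM acc i) by apply: (allP Pacc); apply: mem_nth.
apply: IH; apply: (step_ind); last exact: Pmul false _ Pi.
by apply: step_ind => //; apply: Pmul true _ Pi.
Qed.

(** The unipotent upper triangular matrices form a Sylow 2-subgroup; [B8], all upper triangular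
    matrices, is its normalizer, and the diagonal group [T8] a complement of order 7. *)
Definition U8 := Eval vm_compute in [seq x <- enumSL | let: (a, _, c, _) := x in (a == one8) && (c == zero8)].
Definition B8 := Eval vm_compute in [seq x <- enumSL | let: (_, _, c, _) := x in c == zero8].
Definition T8 := Eval vm_compute in [seq x <- enumSL | let: (_, b, c, _) := x in (b == zero8) && (c == zero8)].
Definition expM x n := iter n (mulM x) oneM.
(** An element of order 9, inverted by the swap [t8]; hence its cube [s8] and [t8] generate the
    group [S8], isomorphic to S_3. *)
Definition c8 : M8 := (zero8, one8, one8, (false, true, false)).
Definition C8 := Eval vm_compute in [seq expM c8 i | i <- iota 0 9].
Definition s8 : M8 := Eval vm_compute in expM c8 3.
Definition t8 : M8 := gen8 true.
Definition S8 := Eval vm_compute in [:: oneM; s8; mulM s8 s8; t8; mulM t8 s8; mulM t8 (mulM s8 s8)].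

Definition conjM (z x : M8) := mulM (mulM z x) (invM z).

(** * Transfer from explicit matrices to [G] *)

Section Model.
Variables (gT : finGroupType) (G : {group gT}) (m : M8 -> gT).
Hypothesis m_hom : forall x y, sl x -> sl y -> sl (mulM x y) /\ m (mulM x y) = (m x * m y)%g.
Hypothesis m_inj : forall x y, sl x -> sl y -> m x = m y -> x = y.
Hypothesis mG : forall g, g \in G <-> exists2 x, sl x & g = m x.

Local Open Scope group_scope.

Lemma slM x y : sl x -> sl y -> sl (mulM x y). Proof. by move=> xS yS; case: (m_hom xS yS). Qed.
Lemma mM x y : sl x -> sl y -> m (mulM x y) = m x * m y.
Proof. by move=> xS yS; case: (m_hom xS yS). Qed.

Lemma mem_m x : sl x -> m x \in G. Proof. by move=> xS; apply/mG; exists x. Qed.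

Lemma m1 : m oneM = 1.
Proof.
have : m oneM = m oneM * m oneM by rewrite -mM.
by move/eqP; rewrite -{1}[m oneM]mulg1 (inj_eq (mulgI _)) eq_sym => /eqP.
Qed.

Lemma slV x : sl x -> sl (invM x).
Proof.
rewrite -!mem_enumSL => xS.
by have /allP/(_ x xS) : all (fun x => invM x \in enumSL) enumSL by vm_compute.
Qed.

Lemma mV x : sl x -> m (invM x) = (m x)^-1.
Proof.
move=> xS; apply/eqP; rewrite -(inj_eq (mulIg (m x))) mulVg -mM ?slV //.
rewrite -mem_enumSL in xS.
have /allP/(_ x xS)/eqP -> : all (fun x => mulM (invM x) x == oneM) enumSL by vm_compute.
by rewrite m1.
Qed.

Lemma sl_gen8 t : sl (gen8 t). Proof. by case: t. Qed.

Lemma card_model : #|G| = 504%N.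
Proof.
have -> : G = [set m x | x in enumSL] :> {set gT}.
  apply/setP=> g; apply/idP/imsetP => [/mG[x xS ->]|[x xS ->]].
    by exists x; rewrite // mem_enumSL.
  by apply: mem_m; rewrite -mem_enumSL.
rewrite card_in_imset; last by move=> x y; rewrite !mem_enumSL; apply: m_inj.
have /card_uniqP -> : uniq enumSL by vm_compute.
by vm_compute.
Qed.

Definition mset (L : seq M8) : {set gT} := [set m x | x in L].

Lemma mem_mset L x : all sl L -> sl x -> (m x \in mset L) = (x \in L).
Proof.
move=> /allP LS xS; apply/imsetP/idP => [[y yL /m_inj -> //]|xL]; last by exists x.
exact: LS.
Qed.

Lemma mset_group_set L : slgroup L -> group_set (mset L).
Proof.
case/and4P=> /allP LS _ L1 /allP LM; apply/group_setP; split.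
  by apply/imsetP; exists oneM; rewrite ?m1.
move=> _ _ /imsetP[x xL ->] /imsetP[y yL ->]; rewrite -mM ?LS //.
by apply: imset_f; apply: (allP (LM x xL)).
Qed.

Lemma card_mset L : slgroup L -> #|mset L| = size L.
Proof.
case/and4P=> /allP LS /card_uniqP <- _ _; rewrite card_in_imset // => x y xL yL.
by apply: m_inj; apply: LS.
Qed.

Lemma mset_subG L : slgroup L -> mset L \subset G.
Proof.
by case/and4P=> /allP LS _ _ _; apply/subsetP=> _ /imsetP[x xL ->]; apply/mem_m/LS.
Qed.

Definition mgen t := m (gen8 t).

(** The search over the trivial subgroup only produces words in the two generators, and it reaches
    all of [enumSL]. *)
Lemma mgen_generate : G = <<[set mgen true; mgen false]>>%G.
Proof.
apply/val_inj/eqP; rewrite eqEsubset /= gen_subG; apply/andP; split; last first.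
  by apply/subsetP=> g; rewrite !inE => /orP[]/eqP->; apply/mem_m/sl_gen8.
apply/subsetP=> _ /mG[x xS ->].
pose Pr x := sl x && (m x \in <<[set mgen true; mgen false]>>).
suff : all Pr (reps [:: oneM]).
  move/allP/(_ x); suff -> : x \in reps [:: oneM] by case/(_ isT)/andP.
  rewrite -mem_enumSL in xS.
  have : let r := reps [:: oneM] in all (fun y => y \in r) enumSL by vm_compute.
  by move/allP/(_ x xS).
apply: bfs_ind => [t y /andP[yS yG]|]; last by rewrite /= /Pr m1 group1.
rewrite /Pr slM ?sl_gen8 // mM ?sl_gen8 // groupM // mem_gen // !inE.
by case: t; rewrite eqxx ?orbT.
Qed.

(** For K the conjugate of L by [x], the coset (y x) K equals (y L) x. Right translation by [x]
    commutes with left multiplication, so the table of L also serves K. *)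
Lemma labelled_coset (K : {group gT}) x L N tab :
  slgroup L -> coset_model L N tab -> x \in G -> K = mset L :^ x :> {set gT} ->
  exists lab : 'I_#|lcosets K G| -> 'I_N, labelled mgen (perm_lat G K) (coset_act tab) lab.
Proof.
move=> Lgrp /and5P[/eqP szr /eqP NL /allP rS /allP rD /allP tabP] xG KE.
have LS : all sl L by case/and4P: Lgrp.
pose rep := nth oneM (reps L).
have repS i : i < N -> sl (rep i) by move=> iN; apply: rS; rewrite mem_nth ?szr.
have repG i : i < N -> m (rep i) * x \in G by move=> iN; rewrite groupM // mem_m ?repS.
have cosetE y y' : sl y -> sl y' -> ((m y * x) *: K == (m y' * x) *: K) = lmem L y y'.
  move=> yS y'S; rewrite eq_sym (sameP eqP lcoset_eqP) mem_lcoset KE mem_conjg.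
  rewrite conjgE invgK invMg !mulgA mulgV mul1g -!mulgA mulgV mulg1.
  by rewrite -mV // -mM ?slV // mem_mset // slM ?slV.
pose c i := (m (rep i) * x) *: K.
have cP (i : 'I_N) : c i \in lcosets K G.
  by apply/lcosetsP; exists (m (rep i) * x); rewrite ?repG.
pose f (i : 'I_N) := enum_rank_in (cP i) (c i).
have fE i : enum_val (f i) = c i by rewrite enum_rankK_in ?cP.
have f_inj : injective f.
  move=> i j /(congr1 enum_val); rewrite !fE => /eqP.
  rewrite cosetE ?repS // => ij; apply/val_inj/eqP.
  have /rD/allP/(_ (j : nat)) : (i : nat) \in iota 0 N by rewrite mem_iota ltn_ord.
  by rewrite mem_iota ltn_ord ij orbF; apply.
have card_cosets : #|lcosets K G| = N.
  have sKG : K \subset G.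
    by rewrite KE -(conjGid xG) conjSg mset_subG.
  have L_gt0 : 0 < size L by rewrite -card_mset // -(cardJg _ x) -KE cardG_gt0.
  apply/eqP; rewrite card_lcosets -(eqn_pmul2r L_gt0) NL -card_model -(Lagrange sKG).
  by rewrite mulnC eqn_pmul2r ?KE ?cardJg ?card_mset.
have actP t k : k < N -> (coset_act tab t k < N) &&
    lmem L (rep (coset_act tab t k)) (mulM (gen8 t) (rep k)).
  move=> kN; have /tabP/allP/(_ k) : t \in [:: true; false] by case: t.
  by rewrite mem_iota; apply.
have [|lab fK labK] := @inj_card_bij _ _ f f_inj; first by rewrite !card_ord card_cosets.
exists lab; split; first by exists f.
  by move=> t k kN; case/andP: (actP t k kN).
move=> t i j; rewrite mxE -{1}(labK j) -{1}(labK i) !fE; congr (nat_of_bool _)%:R%R.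
have jN := ltn_ord (lab j); set k := lab j in jN *.
have /andP[k'N kk'] := actP t k jN.
have -> : lcoset (c k) (mgen t) = (m (mulM (gen8 t) (rep k)) * x) *: K.
  by rewrite lcosetE /c -lcosetM mM ?sl_gen8 ?repS // mulgA.
have /eqP <- : c (coset_act tab t k) == (m (mulM (gen8 t) (rep k)) * x) *: K.
  by rewrite cosetE ?slM ?sl_gen8 ?repS.
by rewrite eq_sym -(fE (lab i)) -(fE (Ordinal k'N)) (inj_eq enum_val_inj) (inj_eq f_inj).
Qed.

(** * Conjugacy of the given subgroups to the explicit ones *)

Lemma enumSLP (P : pred M8) : all P enumSL -> forall x, sl x -> P x.
Proof. by move=> /allP PS x; rewrite -mem_enumSL => /PS. Qed.

Lemma expM_sl x n : sl x -> sl (expM x n) /\ m (expM x n) = m x ^+ n.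
Proof.
move=> xS; elim: n => [|n [IHs IHm]]; first by rewrite m1.
by rewrite -[expM x n.+1]/(mulM x (expM x n)) slM // mM // IHm expgS.
Qed.

Lemma order_m x n : sl x -> (m x ^+ n == 1) = (expM x n == oneM).
Proof.
move=> xS; have [eS <-] := expM_sl n xS; rewrite -m1.
by apply/eqP/eqP => [/m_inj -> //|->].
Qed.

Lemma conjM_sl x y : sl x -> sl y -> sl (conjM x y) /\ m (conjM x y) = m y ^ (m x)^-1.
Proof.
move=> xS yS; rewrite /conjM !(slM, mM, slV, mV, invgK) ?slM ?slV //.
by rewrite conjgE invgK mulgA.
Qed.

Lemma Sylow2_mset L (H : {group gT}) : slgroup L -> size L = 8 -> H \in 'Syl_2(G) ->
  exists2 x, x \in G & H = mset L :^ x :> {set gT}.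
Proof.
rewrite inE => Lg L8 sylH.
apply: (@Sylow_trans 2 gT G (Group (mset_group_set Lg)) H) => //.
by rewrite pHallE mset_subG // card_mset // card_model L8 p_part.
Qed.

Lemma norm_U8 : 'N_G(mset U8) = mset B8.
Proof.
have U8S : all sl U8 by vm_compute.
have B8S : all sl B8 by vm_compute.
apply/setP=> g; rewrite inE; case: (boolP (g \in G)) => [/mG[y yS ->]|gG] /=; last first.
  by symmetry; apply: contraNF gG => /imsetP[y yB ->]; apply/mem_m/(allP B8S).
rewrite mem_mset //.
have /enumSLP/(_ y yS)/eqP <- : all (fun y => all (fun u => conjM (invM y) u \in U8) U8 == (y \in B8))
  enumSL by vm_compute.
have uJ u : u \in U8 -> m u ^ m y = m (conjM (invM y) u) /\ sl (conjM (invM y) u).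
  by move=> /(allP U8S) uS; have [-> ->] := conjM_sl (slV yS) uS; rewrite mV // invgK.
rewrite inE; apply/subsetP/allP => [sub u uU|sub _ /imsetP[_ /imsetP[u uU ->] ->]].
  have [uE uS] := uJ u uU; rewrite -mem_mset // -uE.
  by apply: sub; rewrite memJ_conjg imset_f.
by have [-> uS] := uJ u uU; rewrite mem_mset // sub.
Qed.

Lemma norm_Sylow2 (H : {group gT}) x : x \in G -> H = mset U8 :^ x :> {set gT} ->
  'N_G(H) = mset B8 :^ x.
Proof. by move=> xG ->; rewrite normJ -{1}(conjGid xG) -conjIg norm_U8. Qed.

(** By exhaustion, every element of order 9 has a conjugate in [C8]; a generator of [C] is moved
    there, and the orders agree. *)
Lemma cyclic9_conj (C : {group gT}) : C \subset G -> cyclic C -> #|C| = 9%N ->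
  exists2 x, x \in G & C = mset C8 :^ x :> {set gT}.
Proof.
move=> sCG /cyclicP[c CE] C9; have C8g : slgroup C8 by vm_compute.
have oc : #[c] = 9%N by rewrite orderE -CE.
have /mG[y yS cE] : c \in G by rewrite (subsetP sCG) // CE cycle_id.
have y9 : expM y 9 == oneM by rewrite -order_m // -cE -oc expg_order.
have y3 : expM y 3 != oneM by rewrite -order_m // -cE -order_dvdn oc.
have /enumSLP/(_ y yS) : all (fun y => (expM y 9 == oneM) && (expM y 3 != oneM) ==>
  has (fun z => conjM z y \in C8) enumSL) enumSL by vm_compute.
rewrite y9 y3 => /hasP[z]; rewrite mem_enumSL => zS zyC.
have [zyS zyE] := conjM_sl zS yS.
exists (m z); first exact: mem_m.
apply/eqP; rewrite eqEcard cardJg C9 card_mset // leqnn andbT.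
rewrite CE -[mset C8 :^ m z]/(gval (Group (mset_group_set C8g) :^ m z)) cycle_subG.
by rewrite mem_conjg cE -zyE imset_f.
Qed.

(** First an element of order 3 is conjugated to [s8], then an involution to [t8] without leaving
    the normalizer of the group generated by [s8]. *)
Lemma order6_conj (S : {group gT}) : S \subset G -> #|S| = 6%N ->
  exists2 x, x \in G & S = mset S8 :^ x :> {set gT}.
Proof.
move=> sSG S6; have S8g : slgroup S8 by vm_compute.
have [|s sS os] := @Cauchy _ 3 S isT; first by rewrite S6.
have /mG[y yS sE] := subsetP sSG s sS.
have y3 : expM y 3 == oneM by rewrite -order_m // -sE -os expg_order.
have y1 : y != oneM by apply: contra_eqN os => /eqP y1; rewrite sE y1 m1 order1.
have /enumSLP/(_ y yS) : all (fun y => (expM y 3 == oneM) && (y != oneM) ==>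
  has (fun z => conjM z y == s8) enumSL) enumSL by vm_compute.
rewrite y3 y1 => /hasP[z]; rewrite mem_enumSL => zS /eqP zy.
have [s8S] := conjM_sl zS yS; rewrite zy -sE => s8E.
rewrite zy in s8S.
pose S1 := (S :^ (m z)^-1)%G.
have s8S1 : m s8 \in S1 by rewrite s8E memJ_conjg.
have S1_6 : #|S1| = 6%N by rewrite cardJg.
have sS1G : S1 \subset G by rewrite /= -(conjGid (groupVr (mem_m zS))) conjSg.
have os8 : #[m s8] = 3%N by rewrite s8E orderJ.
have [|t tS1 ot] := @Cauchy _ 2 S1 isT; first by rewrite S1_6.
have /mG[w wS tE] := subsetP sS1G t tS1.
have w2 : expM w 2 == oneM by rewrite -order_m // -tE -ot expg_order.
have w1 : w != oneM by apply: contra_eqN ot => /eqP w1; rewrite tE w1 m1 order1.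
(* The subgroup generated by [s8] has index 2 in [S1], so it is normalized by the involution. *)
have ns8 : conjM w s8 \in [:: oneM; s8; mulM s8 s8].
  have [cS cE] := conjM_sl wS s8S.
  have : m (conjM w s8) \in <[m s8]>.
    rewrite cE -tE memJ_norm ?cycle_id // groupV.
    apply: (subsetP (normal_norm _)) tS1; apply: index2_normal; rewrite ?cycle_subG //.
    by rewrite -divgS ?cycle_subG // S1_6 -orderE os8.
  case/cyclePmin=> i; rewrite os8 => i3; have [eS <-] := expM_sl i s8S.
  by move/m_inj=> -> //; case: i i3 {eS} => [|[|[|//]]].
have /enumSLP/(_ w wS) : all (fun w => [&& expM w 2 == oneM, w != oneM &
    conjM w s8 \in [:: oneM; s8; mulM s8 s8]] ==>
  has (fun z => (conjM z w == t8) && (conjM z s8 \in [:: s8; mulM s8 s8])) enumSL) enumSL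
  by vm_compute.
rewrite w2 w1 ns8 => /hasP[v]; rewrite mem_enumSL => vS /andP[/eqP vw vs8].
have xG : m v * m z \in G by rewrite groupM ?mem_m.
exists (m v * m z) => //.
have [t8S] := conjM_sl vS wS; rewrite vw -tE => t8E; rewrite vw in t8S.
pose S2 := (S1 :^ (m v)^-1)%G.
have S2E : S = S2 :^ (m v * m z) :> {set gT}.
  by rewrite /= -!conjsgM !mulgA mulgKV mulVg conjsg1.
have t8S2 : m t8 \in S2 by rewrite t8E memJ_conjg.
have s8S2 : m s8 \in S2.
  have [cS cE] := conjM_sl vS s8S.
  have : m (conjM v s8) \in S2 by rewrite cE memJ_conjg.
  move: vs8; rewrite !inE => /orP[]/eqP -> //; rewrite mM // => sS2.
  have s3 : m s8 * (m s8 * m s8) = 1 by rewrite -[LHS]/(m s8 ^+ 3) -os8 expg_order.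
  (* If [v] takes [s8] to its square, [s8] is recovered as the square of that square. *)
  have -> : m s8 = (m s8 * m s8) * (m s8 * m s8) by rewrite -mulgA s3 mulg1.
  by rewrite groupM.
rewrite S2E; congr (_ :^ _); apply/esym/eqP; rewrite eqEcard card_mset // !cardJg S6 leqnn andbT.
apply/subsetP=> _ /imsetP[r rS ->]; have ssS := slM s8S s8S.
have ssS2 : m (mulM s8 s8) \in S2 by rewrite mM ?groupM.
have S8E : S8 = [:: oneM; s8; mulM s8 s8; t8; mulM t8 s8; mulM t8 (mulM s8 s8)] by vm_compute.
move: rS; rewrite S8E !inE => /or3P[/eqP->|/eqP->|/or4P[]/eqP->] //; first by rewrite m1 group1.
  by rewrite mM // groupM.
by rewrite mM // groupM.
Qed.


End Model.

Local Open Scope ring_scope.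

(** * The maps Q and b *)

(* The columns of b at the base points of Z[G/S_3], Z, Z[G/H] and Z[G/C_7], found by
   computer search; the rows number the cosets of S_3, C_9, B and B in the order of
   [reps].  The search also produced [vS], [vC], [vB], [vB'], which b maps to the four
   base points of its target. *)
Definition bS : seq int := [::
    -2; -1; -1; 0; -1; 0; 2; -1; 2; 0; 2; 1; 2; -1; 0; 1; 2; 1; 1; 1; -1; -2; 1; -2; 2; -2; -1;
    2; -2; 2; 2; 2; -1; 2; 2; -2; 0; 0; 2; -2; 2; 2; -2; 0; 0; 0; 1; -2; 1; -2; 2; 2; 2; 0; 2;
    2; 1; 1; -2; -2; 1; 1; 1; 2; -1; 2; 1; -1; 2; -2; 0; 1; 0; -1; 0; 2; 2; 0; 0; 2; -1; 0; 0;
    0; 1; 1; 2; -1; 2; 1; -1; 1; -2; 1; 0; -2; 1; 0; -2; -2; 1; 0; -2; -2; 0; 1; 0; 0; 2; 1; 0;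
    1; 1; -1; 1; -2; 1; 1; 2; 2; 0; 1; -1; -1; -2; 1; 2; 1; 1; -1; 1; 1; 0; -2; 0; -2; -2; -2;
    0; 0; -1; -1; 1; 1; 1; -1; -1; -1; -1; 1; 1; -2; -2; -2; 1; 1; 1; 1]%Z.

Definition b1 : seq int := [::
    -2; -2; -2; -2; -2; -2; -2; -2; -2; -2; -2; -2; -2; -2; -2; -2; -2; -2; -2; -2; -2; -2; -2;
    -2; -2; -2; -2; -2; -2; -2; -2; -2; -2; -2; -2; -2; -2; -2; -2; -2; -2; -2; -2; -2; -2; -2;
    -2; -2; -2; -2; -2; -2; -2; -2; -2; -2; -2; -2; -2; -2; -2; -2; -2; -2; -2; -2; -2; -2; -2;
    -2; -2; -2; -2; -2; -2; -2; -2; -2; -2; -2; -2; -2; -2; -2; 1; 1; 1; 1; 1; 1; 1; 1; 1; 1; 1;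
    1; 1; 1; 1; 1; 1; 1; 1; 1; 1; 1; 1; 1; 1; 1; 1; 1; 1; 1; 1; 1; 1; 1; 1; 1; 1; 1; 1; 1; 1; 1;
    1; 1; 1; 1; 1; 1; 1; 1; 1; 1; 1; 1; 1; 1; 3; 3; 3; 3; 3; 3; 3; 3; 3; 1; 1; 1; 1; 1; 1; 1; 1;
    1]%Z.

Definition bU : seq int := [::
    -2; -2; -1; -2; -1; -2; -2; -2; -1; -2; -2; -2; -1; -1; -1; -2; -2; -2; -2; -1; -2; -1; -1;
    -2; -2; -2; -1; -2; -2; -1; -1; -2; -2; -1; -1; -2; -2; -1; -1; -2; -2; -1; -2; -2; -2; -2;
    -1; -2; -2; -2; -2; -1; -2; -2; -2; -1; -2; -1; -2; -2; -2; -2; -2; -2; -2; -2; -1; -2; -1;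
    -1; -2; -2; -2; -2; -2; -2; -1; -1; -2; -2; -2; -1; -2; -1; 0; 0; 0; 0; 0; 1; 0; 1; 0; 0; 0;
    0; 0; 0; 1; 1; 1; 0; -1; 1; 1; 1; 0; -1; 0; 1; 0; 1; 0; 0; 1; 0; 1; 0; -1; -1; 0; 0; -1; -1;
    0; 0; 1; 0; 0; 1; 0; 0; 1; 1; 0; 0; 0; 0; -1; -1; 1; 2; 2; 2; 2; 2; 2; 2; 2; 2; 0; 0; 0; 0;
    0; 0; 0; 0]%Z.

Definition bT : seq int := [::
    0; 0; 0; 0; -1; 0; 0; 1; 0; 0; 0; 2; 0; -1; 0; -1; -2; -2; -1; 1; 1; 1; 1; 0; 2; 0; -1; 0;
    -1; 0; 0; -1; 1; -1; 0; 2; 0; -1; 1; 2; 1; 0; -2; 0; 2; 1; 0; -2; 0; 0; 0; 1; -1; -2; 0; 0;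
    1; 0; 0; -1; 0; 0; 0; 0; -2; 0; -1; 2; 1; 1; 0; 0; 2; 0; 0; -1; -1; 0; -2; 1; 0; 0; 0; 0;
    -1; 1; 1; 0; 0; 1; 1; 0; 1; 0; 0; -1; 1; 1; -1; 0; 0; 1; 1; 1; 1; 1; 0; 0; -1; 1; 1; 1; 0;
    1; 0; 0; 0; 1; 1; 0; 0; 0; -1; 1; 1; 1; 1; 1; 0; 0; 0; 1; 1; -1; -1; 1; 1; 0; 0; 1; 0; 3; 0;
    0; 0; 0; 0; 0; 0; 0; 2; 0; 0; 0; 0; 0; 0; 0]%Z.

Definition vS : seq int := [::
    -5; -8; -8; -8; -8; -8; -9; -8; -9; -9; -9; -8; -9; -8; -9; -8; -10; -8; -9; -9; -8; -10;
    -8; -10; -10; -10; -8; -9; -10; -10; -10; -8; -8; -10; -9; -7; -9; -9; -8; -7; -10; -8; -7;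
    -9; -8; -9; -10; -7; -9; -10; -8; -10; -10; -8; -9; -9; -8; -9; -10; -7; -10; -9; -9; -9;
    -8; -9; -8; -8; -9; -7; -9; -10; -9; -8; -9; -9; -8; -9; -9; -8; -8; -8; -9; -8; 22; -5;
    -12; -4; -3; -7; -5; -6; -6; 5; -4; -4; -4; -9; 6; 4; -6; 1; 2; -2; 12; -10; -6; -5; 2; -7;
    -12; 6; -6; 4; -1; 4; 0; -3; -10; -5; 6; 0; -4; 3; -1; -1; -3; 3; -3; 0; -11; -7; -6; -7;
    -9; 0; 4; -3; 1; -12; 4; -9; -7; -10; -2; 1; -1; -7; 0; 0; 3; 3; 2; 1; 2; 0; 0; 1; 0; -2; 0;
    -1; 0; 3; -1; 1; 5; -2; 3; -3; 0; 5; 3; 3; 0; 0; 3; 5; 2; 3; 3; -2; -2; 3; 5; 2; 2; 1; 1; 0;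
    4; 0; 2; 1; 1; -2; 4; 1; 1; 1; 1; 0; 0; 1; 0; 1; 2; 1; -1; -1; 1; 1; -1; 3; 1; 2; 0; 3; -1;
    0]%Z.

Definition vC : seq int := [::
    11; 11; 11; 11; 8; 11; 15; 14; 7; 11; 7; 11; 15; 11; 11; 11; 8; 11; 8; 14; 11; 14; 11; 14;
    14; 8; 8; 15; 8; 8; 14; 8; 14; 11; 7; 14; 15; 15; 14; 14; 11; 14; 8; 7; 11; 7; 11; 8; 8; 8;
    8; 8; 14; 11; 7; 7; 11; 14; 14; 14; 11; 8; 14; 15; 14; 15; 11; 8; 15; 8; 11; 11; 15; 11; 11;
    7; 8; 11; 7; 14; 11; 11; 11; 11; -28; 1; 6; 3; 5; 9; 6; 4; 5; 7; 6; 9; 2; 3; 5; 2; 8; 2; 3;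
    1; 1; 4; 7; 5; 0; 5; 6; 0; 2; 2; 2; 3; 5; 4; 6; 3; 7; 2; 0; 1; 5; -1; 2; 3; 5; 6; 4; -4; 4;
    5; 4; 2; -1; 4; 3; 5; 0; 2; 6; 6; 5; 0; 2; 6; -2; -1; 0; -1; -3; -4; -2; 0; -5; 0; -3; 0;
    -3; 0; 0; 0; 0; 0; 1; -5; -3; -4; -2; -3; -3; 0; -4; -4; 0; -4; 0; -1; -1; 1; 1; -2; 1; -3;
    1; -1; -1; 2; 1; 0; -3; 0; -2; -3; -4; -3; -2; 1; -2; 0; -2; 2; -2; -2; -2; -1; -2; 0; -1;
    -4; -2; -3; -2; 0; 1; 0; -1; -3]%Z.

Definition vB : seq int := [::
    -77; -77; -75; -77; -75; -77; -77; -77; -75; -77; -77; -77; -75; -75; -75; -77; -77; -77;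
    -77; -75; -77; -75; -75; -77; -77; -77; -75; -77; -77; -75; -75; -77; -77; -75; -75; -77;
    -77; -75; -75; -77; -77; -75; -77; -77; -77; -77; -75; -77; -77; -77; -77; -75; -77; -77;
    -77; -75; -77; -75; -77; -77; -77; -77; -77; -77; -77; -77; -75; -77; -75; -75; -77; -77;
    -77; -77; -77; -77; -75; -75; -77; -77; -77; -75; -77; -75; 194; -12; -27; -16; -28; -33;
    -20; -27; -22; -32; -32; -21; -23; -28; -25; -28; -35; -26; -18; -11; -21; -29; -32; -30;
    -21; -33; -28; -22; -15; -29; -20; -18; -25; -29; -28; -24; -30; -21; -18; -24; -23; -21;
    -23; -25; -26; -27; -27; -16; -30; -28; -29; -25; -21; -23; -24; -28; -21; -23; -34; -31;
    -24; -21; -21; -29; 10; 9; 9; 8; 10; 10; 10; 9; 10; 10; 10; 10; 10; 9; 9; 10; 10; 10; 10;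
    10; 10; 10; 10; 9; 9; 10; 10; 10; 10; 9; 11; 9; 10; 10; 10; 10; 9; 10; 9; 9; 10; 9; 10; 10;
    9; 9; 10; 9; 10; 10; 9; 9; 9; 9; 9; 9; 9; 9; 9; 9; 9; 9; 10; 9; 9; 11; 10; 9; 9; 11; 10; 9]%Z.

Definition vB' : seq int := [::
    0; 0; -3; 0; -3; 0; 0; 0; -3; 0; 0; 0; -3; -3; -3; 0; 0; 0; 0; -3; 0; -3; -3; 0; 0; 0; -3;
    0; 0; -3; -3; 0; 0; -3; -3; 0; 0; -3; -3; 0; 0; -3; 0; 0; 0; 0; -3; 0; 0; 0; 0; -3; 0; 0; 0;
    -3; 0; -3; 0; 0; 0; 0; 0; 0; 0; 0; -3; 0; -3; -3; 0; 0; 0; 0; 0; 0; -3; -3; 0; 0; 0; -3; 0;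
    -3; 3; -5; -3; -4; 0; 2; -10; 0; -1; -2; 5; -19; -1; 2; 2; -3; 1; 5; -25; -11; 2; 3; 3; -3;
    3; -2; 4; 1; -19; -3; 1; 5; 6; 1; -5; 6; 3; 3; 0; 5; 1; 5; 5; -1; -2; 2; 6; 1; -2; 4; -3; 3;
    1; -1; 5; -1; 5; 1; -1; -1; -1; 2; 7; -3; -1; 0; 0; 1; 0; 0; 0; 1; 0; 0; 0; 0; 0; 1; 2; 0;
    0; 0; 1; 1; 0; 0; 0; 2; 0; 0; 1; 0; -1; 0; 0; 0; 0; 1; 0; -1; 0; 1; 1; -1; 0; 1; 0; 1; 1;
    -1; 0; 1; 0; 1; 0; -1; 0; 0; 0; 0; 0; 0; -1; 0; 0; 0; 0; 0; 0; -1; 0; 0; 0; -1; -1; 0]%Z.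

(* Q maps [u_true] and [u_false] to g H - H for the two generators g of G. *)
Definition u_true : seq int := [::
    0; 0; 0; 0; 0; 0; 0; 0; 0; 0; 0; -1; 0; 0; 0; 0; 0; 0; 0; 0; 0; 0; 0; 0; 0; 0; 0; 0; 0; 1;
    -1; 1; 0; 0; 0; 0; 0; 0; -1; 0; -1; 0; 1; 0; -1; 1; 0; 0; 0; 0; -1; 0; 1; 0; 0; 1; 0; 0; 0;
    0; 0; -1; 0; 0; 0; 0; -1; 0; 0; 0; 0; 1; 0; 0; 0; 0; 0; 0; 0; 0; 0; 0; 0; 0; 0; 0; 0; 0; 0;
    0; 0; 0; 0; 0; 0; 0; 0; 0; 0; 0; 0; 0; 0; 0; 0; 0; 0; 0; 0; 0; 0; 0; 0; 0; 0; 0; 0; 0; 0; 0;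
    0; 0; 0; 0; 0; 0; 0; 0; 0; 0; 0; 0; 0; 0; 0]%Z.

Definition u_false : seq int := [::
    -1; 0; 0; 0; 0; 0; 0; 0; 0; 0; 0; 0; 0; 0; 0; 0; 0; 0; 0; 0; 0; 0; 0; 0; 0; 0; 0; 0; 0; 0;
    0; 0; 0; 0; 0; 0; 0; 0; 0; 0; 0; 0; 0; 0; 0; 0; 0; 0; 0; 0; 0; 0; 0; 0; 0; 0; 0; 0; 0; 0; 0;
    0; 0; 0; 0; 0; 0; 0; 0; 0; 0; 0; 0; 0; 0; 0; 0; 0; 0; 0; 0; 0; 0; 0; 0; 0; 0; 0; 0; 0; 0; 0;
    0; 0; 0; 0; 0; 0; 0; 0; 0; 0; 0; 0; 0; 0; 0; 0; 0; 0; 0; 0; 0; 0; 0; 0; 0; 0; 0; 0; 0; 0; 0;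
    0; 0; 0; 0; 0; 0; 0; 0; 0; 0; 0; 0]%Z.

(** The columns of [Q] at the base points H and C_7. In [qT] the entries 1 mark the cosets of H in
    its normalizer, the entries -1 another C_7-orbit. *)
Definition qU : seq int := [::
    1; 0; -1; 0; 0; 0; 0; 0; 0; 0; 0; 0; 0; 0; 0; 0; 0; 0; 0; 0; 0; 0; 0; 0; 0; 0; 0; 0; 0; 0;
    0; 0; 0; 0; 0; 0; 0; 0; 0; 0; 0; 0; 0; 0; 0; 0; 0; 0; 0; 0; 0; 0; 0; 0; 0; 0; 0; 0; 0; 0; 0;
    0; 0]%Z.

Definition qT : seq int := [::
    1; 0; 1; -1; 0; 1; -1; 0; 0; 0; 1; 0; 0; 0; 0; 0; 0; 1; 1; 0; 0; 0; 0; 0; 0; 0; 0; 1; 0; 0;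
    0; 0; -1; 0; 0; 0; 0; 0; 0; 0; -1; 0; 0; 0; 0; 0; 0; 0; 0; 0; 0; 0; 0; -1; 0; -1; 0; 0; 0;
    -1; 0; 0; 0]%Z.

Definition tabS := Eval vm_compute in coset_table S8.
Definition tabC := Eval vm_compute in coset_table C8.
Definition tabB := Eval vm_compute in coset_table B8.
Definition tabU := Eval vm_compute in coset_table U8.
Definition tabT := Eval vm_compute in coset_table T8.
(** The action on the one basis vector of the trivial lattice; it also fills in for the empty sum
    ending each [psum]. *)
Definition act_fix (t : bool) (k : nat) := 0%N.

Definition actP := pcat 63 (coset_act tabU) (pcat 72 (coset_act tabT) act_fix).
Definition act_source := pcat 84 (coset_act tabS) (pcat 1 act_fix actP).
Definition act_target := pcat 84 (coset_act tabS) (pcat 56 (coset_act tabC)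
  (pcat 9 (coset_act tabB) (pcat 9 (coset_act tabB) act_fix))).

(** Big sums are locked; this form can be evaluated. *)
Definition sum_iota N (F : nat -> int) := foldr (fun k s => F k + s) 0 (iota 0 N).

(* The columns of the equivariant matrix whose column at the base point is c. *)
Section Spread.
Variables (p q : bool -> nat -> nat) (M : nat).

Definition permute (t : bool) (c : seq int) : seq int :=
  [seq c`_(find (fun i' => q t i' == i) (iota 0 M)) | i <- iota 0 M].

(** Breadth-first numbering meets new numbers in increasing order, so an image is either the next
    column to append or one already built. *)
Definition spread_step (j : nat) (cols : seq (seq int)) (t : bool) :=
  if p t j == size cols then rcons cols (permute t (nth [::] cols j)) else cols.

Definition spread N (c : seq int) :=
  foldl (fun cols j => foldl (spread_step j) cols [:: true; false]) [:: c] (iota 0 N).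
End Spread.

Definition colsb := Eval vm_compute in
  spread (coset_act tabS) act_target 158 84 bS ++ b1 :: spread (coset_act tabU) act_target 158 63 bU
   ++ spread (coset_act tabT) act_target 158 72 bT.
Definition colsq := Eval vm_compute in
  spread (coset_act tabU) (coset_act tabU) 63 63 qU ++ spread (coset_act tabT) (coset_act tabU) 63 72 qT.

Definition bfun i j := (nth [::] colsb j)`_i.
Definition qfun i j := (nth [::] colsq j)`_i.

Definition all_lt N (P : nat -> bool) := all P (iota 0 N).

Lemma all_ltP N P : all_lt N P -> forall i, (i < N)%N -> P i.
Proof. by move/allP=> PN i iN; apply: PN; rewrite mem_iota. Qed.

Definition equivariant (q p : bool -> nat -> nat) M N (b : nat -> nat -> int) :=
  all (fun t => all_lt M (fun i => all_lt N (fun j => b (q t i) (p t j) == b i j))) [:: true; false].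

Lemma bfun_equivariant : equivariant act_target act_source 158 220 bfun.
Proof. by vm_compute. Qed.
Lemma qfun_equivariant : equivariant (coset_act tabU) actP 63 135 qfun.
Proof. by vm_compute. Qed.
Lemma qfun_sum0 : all_lt 135 (fun j => sum_iota 63 (qfun^~ j) == 0).
Proof. by vm_compute. Qed.
(** Only the row of [Q] at the coset H is tested; equivariance covers the other rows. The offset 84
    + 1 skips the columns of Z[G/S_3] and Z. *)
Lemma bfun_kill : all_lt 158 (fun i => sum_iota 135 (fun j => bfun i (84 + (1 + j)) * qfun 0 j) == 0).
Proof. by vm_compute. Qed.
Lemma qfun_lift t : all_lt 63 (fun i => sum_iota 135 (fun j => qfun i j * (if t then u_true else u_false)`_j)
    == (i == coset_act tabU t 0)%:R - (i == 0)%:R).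
Proof. by case: t; vm_compute. Qed.
(** The numbers of the four base points of the target: partial sums of the ranks 84, 56, 9. *)
Definition bases := [:: 0; 84; 140; 149]%N.
Definition preim (k : nat) := nth [::] [:: vS; vC; vB; vB'] (index k bases).
Lemma bfun_lift : all (fun k => all_lt 158 (fun i =>
    sum_iota 220 (fun j => bfun i j * (preim k)`_j) == (i == k)%:R)) bases.
Proof. by vm_compute. Qed.
Lemma act_target_reachable : reachable 158 act_target bases.
Proof. by vm_compute. Qed.
Lemma actU_reachable : reachable 63 (coset_act tabU) [:: 0]%N.
Proof. by vm_compute. Qed.

Lemma sum_iotaE N F : \sum_(0 <= k < N) F k = sum_iota N F.
Proof. by rewrite unlock /index_iota subn0. Qed.

(** * The resolution and the isomorphism over numbered cosets *)

Section Lattices.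
Variables (gT : finGroupType) (G : {group gT}) (g : bool -> gT).
Hypothesis gG : forall t, g t \in G.
Hypothesis defG : G = <<[set g true; g false]>>%G.
Variables S C H N T : {group gT}.
Variables (labS : 'I_#|lcosets S G| -> 'I_84) (labC : 'I_#|lcosets C G| -> 'I_56)
  (labH : 'I_#|lcosets H G| -> 'I_63) (labN : 'I_#|lcosets N G| -> 'I_9)
  (labT : 'I_#|lcosets T G| -> 'I_72).
Hypotheses (lS : labelled g (perm_lat G S) (coset_act tabS) labS)
  (lC : labelled g (perm_lat G C) (coset_act tabC) labC)
  (lH : labelled g (perm_lat G H) (coset_act tabU) labH)
  (lN : labelled g (perm_lat G N) (coset_act tabB) labN)
  (lT : labelled g (perm_lat G T) (coset_act tabT) labT).

Let P := psum G [:: H; T].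
Let M1 := dsum (perm_lat G S) (dsum (@triv_lat gT) P).
Let M2 := psum G [:: S; C; N; N].

Let lab0 : 'I_0 -> 'I_0 := id.
Let labP := labcat labH (labcat labT lab0).
Let lab1 := labcat labS (labcat (id : 'I_1 -> 'I_1) labP).
Let lab2 := labcat labS (labcat labC (labcat labN (labcat labN lab0))).

Lemma triv_Glattice : is_Glattice G (@triv_lat gT).
Proof. by split=> [|x y _ _]; rewrite /triv_lat ?mulmx1. Qed.

Let latP : is_Glattice G P. Proof. exact: psum_Glattice. Qed.
Let latM1 : is_Glattice G M1.
Proof. exact: dsum_Glattice (perm_lat_Glattice _ _) (dsum_Glattice triv_Glattice latP). Qed.
Let latM2 : is_Glattice G M2. Proof. exact: psum_Glattice. Qed.

Let lP : labelled g P actP labP.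
Proof. exact: labelled_dsum lH (labelled_dsum lT (labelled_psum0 _ _ _)). Qed.

Let l0 : labelled g (@triv_lat gT) act_fix (id : 'I_1 -> 'I_1).
Proof. by split=> [|//|t i j]; [exists id | rewrite !ord1 mxE eqxx]. Qed.

Let lM1 : labelled g M1 act_source lab1.
Proof. exact: labelled_dsum lS (labelled_dsum l0 lP). Qed.

Let lM2 : labelled g M2 act_target lab2.
Proof.
apply: labelled_dsum lS (labelled_dsum lC (labelled_dsum lN (labelled_dsum lN _))).
exact: labelled_psum0.
Qed.

Let Q := relab labH labP qfun.
Let b := relab lab2 lab1 bfun.
Let bP := relab lab2 labP (fun i j => bfun i (84 + (1 + j))).

Lemma equivariantP q p M n f : equivariant q p M n f ->
  forall t i j, (i < M)%N -> (j < n)%N -> f (q t i) (p t j) = f i j.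
Proof.
move=> /allP eqf t i j iM jn; have /eqf/all_ltP/(_ i iM)/all_ltP/(_ j jn)/eqP // : 
  t \in [:: true; false] by case: t.
Qed.

Let bG : Ghom G M1 M2 b.
Proof. by move=> x; apply: (relab_Ghom gG defG latM1 lM1 latM2 lM2 (equivariantP bfun_equivariant)). Qed.

Let QG : Ghom G P (perm_lat G H) Q.
Proof.
move=> x; apply: (relab_Ghom gG defG latP lP (perm_lat_Glattice _ _) lH).
exact: (equivariantP qfun_equivariant).
Qed.

Let bPE : rsubmx (rsubmx b) = bP.
Proof. by apply/matrixP=> i j; rewrite !mxE /lab1 !labcatr. Qed.

Let bE : b = row_mx (lsubmx b) (row_mx (lsubmx (rsubmx b)) bP).
Proof. by rewrite -bPE !hsubmxK. Qed.

Let bPG : Ghom G P M2 bP.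
Proof.
move=> x xG; have := bG xG; rewrite bE /M1 /dsum !mul_row_block !mulmx0 !(add0r, addr0).
by rewrite !mul_mx_row => /eq_row_mx[_] /eq_row_mx[_].
Qed.

Let Qsum0 j : \sum_i Q i j = 0.
Proof.
have [labH_bij _ _] := lH.
under eq_bigr do rewrite mxE.
rewrite (sum_label (fun i => qfun i (labP j)) labH_bij) sum_iotaE; apply/eqP.
exact: (all_ltP qfun_sum0 (ltn_ord (labP j))).
Qed.

(** Induction along the orbit: g v - x0 = g (v - x0) + (g x0 - x0), where the first term is in the
    image by equivariance and the second by [u_true] or [u_false]. *)
Let Qlift x0 (x0E : labH x0 = 0%N :> nat) i :
  exists u : 'cV[int]_(psum_dim G [:: H; T]), delta_mx i 0 - delta_mx x0 0 = Q *m u.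
Proof.
pose Pr (v : 'cV[int]_#|lcosets H G|) := exists u, v - basis x0 = Q *m u.
apply: (labelled_ind (Pr := Pr) lH actU_reachable) => [j|].
  rewrite inE => /eqP j0; exists 0; rewrite mulmx0.
  by have -> : j = x0; [apply/(label_inj lH)/val_inj; rewrite /= j0 x0E | rewrite subrr].
move=> t v [u vu].
have [y yE] : exists y, perm_lat G H (g t) *m basis x0 = basis y /\ 
     labH y = coset_act tabU t 0 :> nat.
  have [_ pN _] := lH; have [y yE] := label_surj lH (pN t 0%N isT).
  by exists y; split=> //; apply: (labelled_basis lH); rewrite x0E.
have [yx0 labyE] := yE.
exists (P (g t) *m u + \col_j (if t then u_true else u_false)`_(labP j)).
rewrite mulmxDr (relab_mul_col _ lP qfun) mulmxA QG // -mulmxA -vu mulmxBr yx0.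
rewrite -addrA; congr (_ + _); apply/matrixP=> a k; rewrite !mxE ord1 eqxx !andbT.
rewrite sum_iotaE (eqP (all_ltP (qfun_lift t) (ltn_ord (labH a)))) -labyE.
rewrite (inj_eq val_inj) (inj_eq (label_inj lH)).
have -> : (labH a == 0%N :> nat) = (a == x0).
  by rewrite -(inj_eq (label_inj lH)) -val_eqE /= x0E.
by rewrite addKr.
Qed.

(** The composite is equivariant on Z[G/H], so its vanishing at the base point propagates. *)
Let bQ0 : bP *m Q^T = 0.
Proof.
have QTG x : x \in G -> Q^T *m perm_lat G H x = P x *m Q^T.
  move=> xG; have /(congr1 trmx) := QG (groupVr xG).
  by rewrite !trmx_mul tr_psum ?groupV // tr_perm_lat ?groupV // invgK.
have H0 : forall j, bP *m Q^T *m basis j = 0.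
  apply: (labelled_ind (Pr := fun v => bP *m Q^T *m v = 0) lH actU_reachable) => [j|t v v0].
    rewrite inE => /eqP j0; rewrite -mulmxA.
    have -> : Q^T *m basis j = \col_k qfun 0 (labP k).
      by apply/matrixP=> i k; rewrite mulmx_basis !mxE j0.
    rewrite (relab_mul_col _ lP); apply/matrixP=> i k; rewrite !mxE sum_iotaE; apply/eqP.
    exact: (all_ltP bfun_kill (ltn_ord (lab2 i))).
  by rewrite mulmxA -(mulmxA bP) QTG // (mulmxA bP) bPG // -!mulmxA (mulmxA bP) v0 mulmx0.
apply/matrixP=> i j; move: (H0 j) => /matrixP/(_ i 0).
by rewrite mulmx_basis !mxE.
Qed.

(** The image of [b] is stable under the generators and contains the four base points, hence every
    basis vector. *)
Let b_onto : exists c, b *m c = 1%:M.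
Proof.
have /fin_all_exists[w bw] j : exists w, basis j = b *m w.
  apply: (labelled_ind (Pr := fun v => exists w, v = b *m w) lM2 act_target_reachable) => [i|t v [w ->]].
    move=> ib; exists (\col_j (preim (lab2 i))`_(lab1 j)).
    rewrite (relab_mul_col _ lM1); apply/matrixP=> k l; rewrite !mxE sum_iotaE ord1 eqxx andbT.
    move/allP: bfun_lift => /(_ _ ib)/all_ltP/(_ _ (ltn_ord (lab2 k)))/eqP ->.
    by rewrite (inj_eq val_inj) (inj_eq (label_inj lM2)).
  by exists (M1 (g t) *m w); rewrite !mulmxA bG.
exists (\matrix_(i, j) w j i 0); apply/matrixP=> i j.
by have /matrixP/(_ i 0) := bw j; rewrite !mxE eqxx andbT => ->; apply: eq_bigr => l _; rewrite mxE.
Qed.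

Lemma label_card n m (lab : 'I_n -> 'I_m) : bijective lab -> n = m.
Proof. by move/bij_eq_card; rewrite !card_ord. Qed.

(** Presents the trivial lattice as Z[G/G], the form in which [stably_perm] admits it. *)
Lemma Giso_perm_lat_full : Giso G (perm_lat G G) (@triv_lat gT).
Proof.
have n1 : #|lcosets G G| = 1%N by rewrite card_lcosets indexgg.
exists (const_mx 1), (const_mx 1); split.
- move=> x xG; apply/matrixP=> i j; rewrite !mxE.
  rewrite (bigD1 (cact x j)) //= big1 => [|l nl]; last first.
    by rewrite perm_latE // (negPf nl) mulr0.
  by rewrite perm_latE // eqxx !mxE mulr1 addr0 big_ord1 !ord1 !mxE mulr1.
- apply/matrixP=> i j; rewrite !mxE big_ord1 !mxE mulr1.
  have lt1 (k : 'I_#|lcosets G G|) : (k < 1)%N by apply: leq_trans (ltn_ord k) _; rewrite n1.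
  suff -> : i = j by rewrite eqxx.
  by apply: ord_inj; move: (lt1 i) (lt1 j); rewrite !ltnS !leqn0 => /eqP -> /eqP ->.
- apply/matrixP=> i j; rewrite !ord1 !mxE (eq_bigr (fun _ => 1)) => [|l _]; last by rewrite !mxE mulr1.
  by rewrite sumr_const card_ord n1.
Qed.

Lemma chevalley_resolution k (tau : glat gT k) (B : 'M[int]_(#|lcosets H G|, k)) :
  aug_ideal G H tau B ->
  exists (p : nat) (P : glat gT p) (Fl : glat gT 73) (i : 'M[int]_(p, k)) (pi : 'M[int]_(73, p)),
    [/\ flabby_resolution G (dual_lat tau) P Fl i pi,
        Giso G (psum G [:: S; C; N; N]) (dsum (perm_lat G S) (dsum (@triv_lat gT) Fl)) &
        stably_perm G Fl].
Proof.
move=> augB; have [x0 x0E] := label_surj lH (isT : (0 < 63)%N).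
have [_ _ nH] := aug_ideal_retract augB x0.
have cS := label_card (let: And3 h _ _ := lS in h).
have cC := label_card (let: And3 h _ _ := lC in h).
have cH := label_card (let: And3 h _ _ := lH in h).
have cN := label_card (let: And3 h _ _ := lN in h).
have cT := label_card (let: And3 h _ _ := lT in h).
(* Here k = 63 - 1 = 62 and 63 + 72 = 62 + 73. *)
have pE : psum_dim G [:: H; T] = (k + 73)%N.
  by move: nH; rewrite /= cH cT => -[<-].
have permP : is_perm G P by exists [:: H; T]; apply: Giso_refl.
have [Fl [i [pi [s [latF iG piG exact_ipi [pis bspi]]]]]] :=
  dual_resolution augB latP permP (@tr_psum _ G [:: H; T]) pE QG Qsum0 (Qlift x0E).
have isoF : Giso G (dsum (perm_lat G S) (dsum (@triv_lat gT) Fl)) M2.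
  have [c bc] := b_onto.
  (* The quotient is the identity on Z[G/S_3] and Z, and [pi] on [P]; [b] factors through it because
     it kills the image of the transpose of [Q]. *)
  apply: (Giso_quotient (Pi := block_mx 1%:M 0 0 (block_mx 1%:M 0 0 pi))
    (s := block_mx 1%:M 0 0 (block_mx 1%:M 0 0 s)) _ _ _ bG _ bc).
  - by rewrite /= cS cC cN.
  - move=> x xG; rewrite /M1 /dsum !mulmx_block.
    by rewrite !(mulmx0, mul0mx, mulmx1, mul1mx, addr0, add0r) piG.
  - by rewrite !mulmx_block !mulmx0 !mul0mx !mulmx1 !(addr0, add0r) pis -!scalar_mx_block.
  - rewrite -mulmxA !mulmx_block !mulmx0 !mul0mx !mulmx1 !(addr0, add0r).
    rewrite {1}bE !mul_row_block !mulmx0 !mulmx1 !(addr0, add0r).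
    by rewrite mulmxA bspi // -bE.
have stF : stably_perm G Fl.
  exists [:: S; G], [:: S; C; N; N]; apply: Giso_trans isoF.
  apply: Giso_trans (Giso_dsumC _ _ _) _.
  apply: Giso_trans (Giso_dsum _ (Giso_refl G Fl)) _.
    apply: Giso_dsum (Giso_refl _ _) _.
    exact: Giso_trans (Giso_dsum0 _ _ _) Giso_perm_lat_full.
  exact: Giso_sym (Giso_dsumA _ _ _ _).
exists _, P, Fl, i, pi; split=> //; last exact: Giso_sym.
by split=> //; split=> //; apply: stably_perm_flabby.
Qed.

End Lattices.

Local Close Scope ring_scope.

(** * Assembly for the given subgroups *)

Lemma coset_models :
  [/\ coset_model S8 84 tabS, coset_model C8 56 tabC, coset_model U8 63 tabU,
      coset_model B8 9 tabB & coset_model T8 72 tabT].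
Proof. by split; vm_compute. Qed.

Lemma slgroups : [/\ slgroup S8, slgroup C8, slgroup U8, slgroup B8 & slgroup T8].
Proof. by split; vm_compute. Qed.

Theorem theorem1p3 (F : finFieldType) (hF : #|F| = 8)
  (H S C : {group coset_of 'Z(SL2 F)}) :
  H \in ('Syl_2(PSL2 F))%g ->
  S \subset PSL2 F -> S \isog [set: 'S_3] ->
  C \subset PSL2 F -> cyclic C -> #|C| = 9 ->
  forall (k : nat) (tau : glat _ k) (B : 'M[int]_(#|lcosets H (PSL2 F)|, k)),
    aug_ideal (PSL2 F) H tau B ->
    (* J_{G/H} = Hom_Z(I_{G/H}, Z) = dual_lat tau *)
    exists (p : nat) (P : glat _ p) (Fl : glat _ 73)
           (i : 'M[int]_(p, k)) (pi : 'M[int]_(73, p)),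
      [/\ flabby_resolution (PSL2 F) (dual_lat tau) P Fl i pi,
          Giso (PSL2 F)
            (psum (PSL2 F) [:: S; C; 'N_(PSL2 F)(H)%G; 'N_(PSL2 F)(H)%G])
            (dsum (perm_lat (PSL2 F) S) (dsum (@triv_lat _) Fl))
        & stably_perm (PSL2 F) Fl].
Proof.
move=> sylH sSG isoS sCG cycC C9 k tau B augB.
have [m [mM m_inj mG]] := PSL2_model hF.
have [mS mC mU mB mT] := coset_models.
have [slS slC slU slB slT] := slgroups.
have S6 : #|S| = 6 by rewrite (card_isog isoS) cardsT card_Sn.
have [x xG SE] := order6_conj mM m_inj mG sSG S6.
have [y yG CE] := cyclic9_conj mM m_inj mG sCG cycC C9.
have [z zG HE] := Sylow2_mset mM m_inj mG slU (erefl _) sylH.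
have NE := norm_Sylow2 mM m_inj mG zG HE.
(* Only the coset table of C_7 enters, so the diagonal group itself can be used; the trivial
   conjugation fits it to [labelled_coset]. *)
pose T := Group (mset_group_set mM slT).
have TE : T = (mset m T8 :^ 1)%g :> {set _} by rewrite conjsg1.
have lab := labelled_coset mM m_inj mG.
have [labS lS] := lab _ _ _ _ _ slS mS xG SE.
have [labC lC] := lab _ _ _ _ _ slC mC yG CE.
have [labH lH] := lab _ _ _ _ _ slU mU zG HE.
have [labN lN] := lab _ _ _ _ _ slB mB zG NE.
have [labT lT] := lab _ _ _ _ _ slT mT (group1 _) TE.
apply: (chevalley_resolution _ (mgen_generate mM mG) lS lC lH lN lT augB).
by move=> t; apply/(mem_m mG)/sl_gen8.
Qed.
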